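(* Let $1<\alpha<2$ and $\tfrac12\le r\le1$, and let $\beta$, $\rho^{(a,b)}$, $q_N$, $q$ and the norms and semi-norms be as defined in the context. For $j\in\mathbb{N}$ and $0\le\mu\le j$, if $D^jf\in L^2_{\rho^{(\beta+j-1,\alpha-\beta+j-1)}}(0,1)$, then there exists $C>0$ (independent of $N$ and $\alpha$) such that $$\Big\|\frac{q-q_N}{\rho^{(\alpha-\beta,\beta)}}\Big\|_{\mu,\,\rho^{(\alpha-\beta,\beta)},\,A}\ \le\ C\,N^{-(\alpha-1)}\,\big(N(N+\alpha-2)\big)^{\frac{\mu-j}{2}}\,|f|_{j,\,\rho^{(\beta-1,\alpha-\beta-1)},\,A}.$$
   Context: All functions are real-valued on $(0,1)$; $D$ denotes the derivative in $x$; $\mathbb{N}=\{1,2,\dots\}$. Weights: $\rho^{(a,b)}(x):=(1-x)^a x^b$. For $\omega>0$ on $(0,1)$, $L^2_\omega(0,1)$ is the space of $f$ with $\|f\|_\omega:=\big(\int_0^1\omega(x) f(x)^2\,dx\big)^{1/2}<\infty$. For an integer $s\ge0$, $$\|v\|_{s,\,\rho^{(a,b)},\,A}:=\Big(\sum_{l=0}^{s}\|D^lv\|^2_{\rho^{(a+l,b+l)}}\Big)^{1/2},\qquad |v|_{s,\,\rho^{(a,b)},\,A}:=\|D^sv\|_{\rho^{(a+s,b+s)}}.$$ Given $1<\alpha<2$ and $r$, the number $\beta$ with $\alpha-1\le\beta\le1$ is determined by $r=\dfrac{\sin(\pi\beta)}{\sin(\pi(\alpha-\beta))+\sin(\pi\beta)}$.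 Put $k(x):=(1-x)^{\alpha-\beta-1}x^{\beta-1}$. Shifted Jacobi polynomials (for $a,b>-1$): $G_n^{(a,b)}(x):=P_n^{(a,b)}(2x-1)$, where $P_n^{(a,b)}(y)=2^{-n}\sum_{m=0}^n\binom{n+a}{m}\binom{n+b}{n-m}(y-1)^{n-m}(y+1)^m$ is the usual Jacobi polynomial. Their norms are $$|\|G_n^{(a,b)}|\|:=\Big(\int_0^1(1-x)^a x^b\,G_n^{(a,b)}(x)^2\,dx\Big)^{1/2}=\Big(\tfrac{1}{2n+a+b+1}\tfrac{\Gamma(n+a+1)\Gamma(n+b+1)}{\Gamma(n+1)\Gamma(n+a+b+1)}\Big)^{1/2}.$$ Constants: $\lambda_n:=\dfrac{\sin(\pi\alpha)}{\sin(\pi(\alpha-\beta))+\sin(\pi\beta)}\dfrac{\Gamma(n+\alpha)}{n!}$ for $n\ge0$, and $\lambda_{-1}:=-(1-r)\Gamma(\alpha)\dfrac{\sin(\pi\alpha)}{\sin(\pi(\alpha-\beta))}$, which equals $-\Gamma(\alpha)\dfrac{\sin(\pi\alpha)}{\sin(\pi(\alpha-\beta))+\sin(\pi\beta)}$ (the latter expression is used when $r=1$). For $f\in L^2_{\rho^{(\beta-1,\alpha-\beta-1)}}(0,1)$ (standing assumption on $f$, needed to define $q$) set $f_i:=\int_0^1\rho^{(\beta-1,\alpha-\beta-1)}(x)f(x)G_i^{(\beta-1,\alpha-\beta-1)}(x)\,dx$ for $i\ge0$, $c_i:=\dfrac{f_{i+1}}{\lambda_i\,|\|G_{i+1}^{(\beta-1,\alpha-\beta-1)}|\|^2}$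 for $i\ge-1$, and $$q_N(x):=c_{-1}\,x\,k(x)+\rho^{(\alpha-\beta,\beta)}(x)\sum_{i=0}^{N-1}c_i\,G_i^{(\alpha-\beta,\beta)}(x).$$ The function $q$ is defined by $q-c_{-1}xk:=\lim_{N\to\infty}(q_N-c_{-1}xk)$, the limit being taken in $L^2_{\rho^{(-(\alpha-\beta),-\beta)}}(0,1)$ (where it exists).
   Formalization: Requires N ≥ 1 and N ≥ j−1: for smaller N a polynomial f of degree N+1 makes the right side 0 but not the left. For r = 1/2, C is uniform only for α ≥ α₀ > 1, since λ_n → 0 as α → 1; for r > 1/2 it is uniform on (1,2). *)

(* Defs.v *)
From HB Require Import structures.
From mathcomp Require Import all_boot all_order all_algebra.
From mathcomp Require Import all_classical all_reals all_analysis.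

Set Implicit Arguments.
Unset Strict Implicit.
Unset Printing Implicit Defensive.
Import Order.TTheory GRing.Theory Num.Theory.
Import numFieldNormedType.Exports.

Local Open Scope classical_set_scope.
Local Open Scope ring_scope.

(* Functions on (0,1) are represented by total functions R -> R, of which only
   the values on `]0, 1[ matter. *)

Section Spaces.
Variable R : realType.
Implicit Types (a b x : R) (v g w phi : R -> R).
Local Notation mu := (@lebesgue_measure R).
Local Notation I01 := (`]0%R, 1%R[%classic : set R).

Definition rho a b : R -> R := fun x => (1 - x) `^ a * x `^ b.

Definition L2norm w v : \bar R :=
  sqrte (\int[mu]_(x in I01) (w x * v x ^+ 2)%:E)%E.

Definition inL2 w v : Prop :=
  measurable_fun (I01 : set (measurableTypeR R)) v /\ (L2norm w v < +oo)%E.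

Definition test_function phi : Prop :=
  (forall n x, derivable (derive1n n phi) x 1) /\
  exists K : set R, [/\ compact K, K `<=` I01 &
    forall x, ~ K x -> phi x = 0].

Definition weak_derivative (l : nat) v g : Prop :=
  [/\ locally_integrable I01 v, locally_integrable I01 g &
    forall phi, test_function phi ->
      \int[mu]_(x in I01) (v x * derive1n l phi x) =
      (-1) ^+ l * \int[mu]_(x in I01) (g x * phi x)].

Definition weakly_derivable (l : nat) v : Prop :=
  exists g, weak_derivative l v g.

(* The weak derivative, determined up to a null set; it is a meaningless
   function when v has no weak derivative of order l. *)
Definition weakD (l : nat) v : R -> R := get (weak_derivative l v).

(* +oo when the weak derivative does not exist. *)
Definition seminormA (s : nat) a b v : \bar R :=
  if `[< weakly_derivable s v >]
  then L2norm (rho (a + s%:R) (b + s%:R)) (weakD s v) else +oo%E.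

Definition normA (s : nat) a b v : \bar R :=
  sqrte (\sum_(l < s.+1) seminormA l a b v ^+ 2)%E.

End Spaces.

Section Jacobi.
Variable R : realType.
Implicit Types (a b x y z : R).
Local Notation mu := (@lebesgue_measure R).
Local Notation I01 := (`]0%R, 1%R[%classic : set R).

Definition Gamma z : R :=
  \int[mu]_(t in (`]0%R, +oo[%classic : set R)) (t `^ (z - 1) * expR (- t)).

(* The binomial coefficient with a real upper argument. *)
Definition gbinom z (m : nat) : R :=
  (\prod_(i < m) (z - i%:R)) / m`!%:R.

Definition jacobi (n : nat) a b y : R :=
  2 ^- n * \sum_(m < n.+1)
    gbinom (n%:R + a) m * gbinom (n%:R + b) (n - m) *
    (y - 1) ^+ (n - m) * (y + 1) ^+ m.

Definition Gpoly (n : nat) a b x : R := jacobi n a b (2 * x - 1).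

Definition Gnorm (n : nat) a b : R :=
  Num.sqrt (\int[mu]_(x in I01) (rho a b x * Gpoly n a b x ^+ 2)).

End Jacobi.

Section Model.
Variable R : realType.
Implicit Types (r alpha beta x : R) (f q : R -> R).
Local Notation mu := (@lebesgue_measure R).
Local Notation I01 := (`]0%R, 1%R[%classic : set R).

Definition sin_sum alpha beta : R :=
  sin (pi * (alpha - beta)) + sin (pi * beta).

Definition is_beta r alpha beta : Prop :=
  alpha - 1 <= beta <= 1 /\ r = sin (pi * beta) / sin_sum alpha beta.

Definition kfun alpha beta x : R :=
  (1 - x) `^ (alpha - beta - 1) * x `^ (beta - 1).

Definition lambda alpha beta (n : nat) : R :=
  sin (pi * alpha) / sin_sum alpha beta * (Gamma (n%:R + alpha) / n`!%:R).

(* lambda_{-1}; both branches are the same number when r <> 1, but the generic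
   one reads 0 / 0 when r = 1. *)
Definition lambda_m1 r alpha beta : R :=
  if r == 1 then - (Gamma alpha * (sin (pi * alpha) / sin_sum alpha beta))
  else - ((1 - r) * Gamma alpha *
          (sin (pi * alpha) / sin (pi * (alpha - beta)))).

Definition fcoef alpha beta f (i : nat) : R :=
  \int[mu]_(x in I01) (rho (beta - 1) (alpha - beta - 1) x * f x *
                           Gpoly i (beta - 1) (alpha - beta - 1) x).

Definition c_m1 r alpha beta f : R :=
  fcoef alpha beta f 0 /
  (lambda_m1 r alpha beta * Gnorm 0 (beta - 1) (alpha - beta - 1) ^+ 2).

Definition ccoef alpha beta f (i : nat) : R :=
  fcoef alpha beta f i.+1 /
  (lambda alpha beta i * Gnorm i.+1 (beta - 1) (alpha - beta - 1) ^+ 2).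

Definition qN r alpha beta f (N : nat) x : R :=
  c_m1 r alpha beta f * x * kfun alpha beta x +
  rho (alpha - beta) beta x *
  \sum_(i < N) ccoef alpha beta f i * Gpoly i (alpha - beta) beta x.

(* q - c_{-1} x k is the limit of q_N - c_{-1} x k in the weighted L2 space. *)
Definition is_q r alpha beta f q : Prop :=
  let w := rho (- (alpha - beta)) (- beta) in
  let s x := c_m1 r alpha beta f * x * kfun alpha beta x in
  inL2 w (fun x => q x - s x) /\
  (fun N : nat =>
     L2norm w (fun x => (q x - s x) - (qN r alpha beta f N x - s x)))
    @ \oo --> 0%E.

End Model.

(* Main.v *)
(* With a = alpha - beta, the quotient (q - q_N) / rho^(a,beta) is the tail, from
   i = N on, of the series of c_i G_i^(a,beta).  Derivatives of Jacobi
   polynomials are again orthogonal, so the squared l-th seminorm of the tail is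
   the sum of the c_i^2 |||G_i^(a,beta)|||^2 times eigenvalues growing like
   i^(2l).  Since lambda_i c_i is the (i+1)-st Jacobi coefficient of f, Bessel's
   inequality for D^j f bounds the same sum with weights lambda_i^2 i^(2j), and
   the quotient of the weights is estimated termwise from
   Gamma (i + alpha) / i! >= (i+1)^(alpha-1) / 2 and from a lower bound of the
   trigonometric factor of lambda_i.  The weak derivatives are computed by
   testing against the weight times polynomials, cut off smoothly near 0 and 1. *)
Require Import Defs.
From mathcomp Require Import all_boot all_order all_algebra.
From mathcomp Require Import ring lra.
From mathcomp Require Import all_classical all_reals all_analysis measurable_realfun.
Import Order.TTheory GRing.Theory Num.Theory.
Import numFieldNormedType.Exports.
Set Implicit Arguments.
Unset Strict Implicit.
Unset Printing Implicit Defensive.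
Local Open Scope classical_set_scope.
Local Open Scope ring_scope.

(** The quotient is known only as an L2 limit, so its weak derivatives have to be produced: the l-th
    derivatives of its partial sums are Cauchy in a weighted L2 space, completeness gives a limit,
    and weak derivatives are closed under such limits. Since [weakD] is a choice made by [get], its
    norm can be computed only after uniqueness almost everywhere. The weights of f may be singular
    at both endpoints, so boundary terms cannot be evaluated. The operator x (1 - x) d/dx, unlike
    d/dx, stays bounded on rescaled cutoffs uniformly in the scale, which lets integration by parts
    survive the removal of the cutoff. Uniformity in alpha rests on the factor sin (pi alpha) /
    [sin_sum], whose square is cos^2 + (2 r - 1)^2 sin^2 at pi alpha / 2. It degenerates only for r
    = 1/2 and alpha -> 1, the case shut out by the alternative on r and [alpha0]. The eigenvalue of
    order j vanishes at degrees below j, where Bessel's inequality gives no control of c_i;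
    [j <= N.+1] keeps the degrees i + 1 of the tail above that range. *)

Section FlatFunctions.

(** * Flat functions and smooth cutoffs *)

Variable R : realType.
Implicit Types (S T P : {poly R}) (x y u k : R).

Lemma expr_le_fact_expR (n : nat) u : 0 <= u -> u ^+ n <= n`!%:R * expR u.
Proof.
move=> u0; case: n => [|n].
  by rewrite expr0 fact0 mul1r -[leLHS]expR0 ler_expR.
have := expR_ge1Dxn n u0 => h.
have hf : 0 < n.+1`!%:R :> R by rewrite ltr0n fact_gt0.
rewrite mulrC -ler_pdivrMr//; apply: le_trans h; by rewrite lerDr.
Qed.

Lemma horner_expRN_bounded P :
  exists2 C, 0 <= C & forall u, 0 <= u -> `|P.[u] * expR (- u)| <= C.
Proof.
elim/poly_ind: P => [|P c [C C0 hC]].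
  by exists 0 => // u _; rewrite horner0 mul0r normr0.
suff [D D0 hD] : exists2 D, 0 <= D & forall u, 0 <= u -> `|(P * 'X).[u] * expR (- u)| <= D.
  exists (D + `|c|) => [|u u0]; first by rewrite addr_ge0.
  rewrite !hornerE mulrDl (le_trans (ler_normD _ _))// lerD//.
    by have := hD _ u0; rewrite !hornerE.
  rewrite normrM ler_piMr// ger0_norm ?expR_ge0// expR_le1; lra.
exists (\sum_(i < size (P * 'X)) `|(P * 'X)`_i| * i`!%:R) => [|u u0].
  by apply: sumr_ge0 => i _; rewrite mulr_ge0.
rewrite horner_coef mulr_suml (le_trans (ler_norm_sum _ _ _))//.
apply: ler_sum => i _; rewrite -mulrA normrM ler_wpM2l//.
rewrite ger0_norm ?mulr_ge0 ?exprn_ge0 ?expR_ge0//.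
rewrite expRN ler_pdivrMr ?expR_gt0//; exact: expr_le_fact_expR.
Qed.

(* S |-> flat S y runs over exp (-1/y) and all its derivatives. *)
Definition flat S y : R := if 0 < y then S.[y^-1] * expR (- y^-1) else 0.

Lemma flat_le0 S y : y <= 0 -> flat S y = 0.
Proof. by move=> y0; rewrite /flat ltNge y0. Qed.

Lemma flat_gt0 S y : 0 < y -> flat S y = S.[y^-1] * expR (- y^-1).
Proof. by move=> y0; rewrite /flat y0. Qed.

Lemma flat_bounded S : exists2 C, 0 <= C & forall y, `|flat S y| <= C.
Proof.
have [C C0 hC] := horner_expRN_bounded S; exists C => // y.
rewrite /flat; case: ifPn => [y0|_]; last by rewrite normr0.
by apply: hC; rewrite invr_ge0 ltW.
Qed.

(** Extracts a factor y from a flat function at the cost of one degree in [S]. This yields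
    continuity at 0 and, in [is_derive_flat], a difference quotient at 0 that is again flat. *)
Lemma flat_mulX S y : y * flat (S * 'X) y = flat S y.
Proof.
have [y0|y0] := ltP 0 y; last by rewrite !flat_le0// mulr0.
rewrite !flat_gt0// hornerMX; field; by rewrite gt_eqF.
Qed.

Lemma flat_linear_bound S : exists2 C, 0 <= C & forall y, `|flat S y| <= C * `|y|.
Proof.
have [C C0 hC] := flat_bounded (S * 'X); exists C => // y.
by rewrite -flat_mulX normrM mulrC ler_wpM2r.
Qed.

(** The chain rule in the variable 1/y: differentiating S(1/y) exp(-1/y) produces y^-2 (S - S')(1/y)
    exp(-1/y). *)
Definition flat_step S : {poly R} := 'X ^+ 2 * (S - S^`()%R).

Lemma flat_cvg0 S : flat S y @[y --> 0] --> (0 : R).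
Proof.
have [C C0 hC] := flat_linear_bound S.
apply: norm_cvg0.
apply: (@squeeze_cvgr _ _ _ _ (fun=> 0) (fun y => C * `|y|)).
- by near=> y; rewrite normr_ge0 hC.
- exact: cvg_cst.
- rewrite -[X in _ --> X](mulr0 C) -[X in _ * X](@normr0 _ R).
  apply: cvgMr; apply: cvg_norm; exact: cvg_id.
Unshelve. all: by end_near. Qed.


Lemma is_derive_mul (f g : R -> R) x (df dg : R) :
  is_derive x 1 f df -> is_derive x 1 g dg ->
  is_derive x 1 (fun z => f z * g z) (df * g x + f x * dg).
Proof.
move=> hf hg; apply: is_derive_eq (is_deriveM hf hg) _.
rewrite -[f x *: dg]/(f x * dg) -[g x *: df]/(g x * df); ring.
Qed.

Lemma is_derive_affine (k b x : R) : is_derive x 1 (fun z => k * z + b) k.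
Proof.
have -> : (fun z => k * z + b) = horner (k *: 'X + b%:P).
  by apply/funext => z; rewrite !hornerE.
by apply: is_derive_eq; rewrite derivD derivZ derivX derivC addr0 hornerZ hornerC mulr1.
Qed.

Lemma is_derive_flat S y : is_derive y 1 (flat S) (flat (flat_step S) y).
Proof.
have [y0|y0|<-] := ltgtP 0 y.
- have y0' : y != 0 by rewrite gt_eqF.
  apply: (@near_eq_is_derive _ _ _ (fun z : R => S.[z^-1] * expR (- z^-1))).
    by near=> z; rewrite flat_gt0//; near: z; exact: lt_nbhsr.
  have dV : is_derive y 1 (fun z : R => z^-1) (- y ^- 2).
    by apply: is_derive_eq (is_deriveV _ _) _ => //=; rewrite scaler1.
  have dS : is_derive y 1 (fun z : R => S.[z^-1]) (S^`()%R.[y^-1] * - y ^- 2).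
    exact: is_derive1_comp.
  have dE : is_derive y 1 (fun z : R => expR (- z^-1)) (expR (- y^-1) * y ^- 2).
    have := @is_derive1_comp _ expR (fun z : R => - z^-1) y _ _ (is_derive_expR _) (is_deriveN dV).
    by rewrite opprK.
  apply: is_derive_eq (is_derive_mul dS dE) _.
  rewrite /flat_step flat_gt0// hornerM hornerXn hornerD hornerN -!exprVn; ring.
- apply: (@near_eq_is_derive _ _ _ (cst 0)).
    by near=> z; rewrite flat_le0// ltW//; near: z; exact: lt_nbhsl.
  by apply: is_derive_eq; rewrite flat_le0// ltW.
(* At 0 the difference quotient of [flat S] is [flat (S * 'X)], which tends to 0. *)
- have h : h^-1 *: ((flat S \o shift 0) (h *: 1) - flat S 0) @[h --> (0:R)^'] --> (0 : R).
    apply: (@cvg_trans _ (flat (S * 'X) h @[h --> (0:R)^'])); last first.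
      by apply: cvg_within_filter; exact: flat_cvg0.
    apply: near_eq_cvg; near=> h.
    have h0 : h != 0 by near: h; exact: nbhs_dnbhs_neq.
    rewrite /= (flat_le0 _ (lexx 0)) subr0 addr0 -[h *: 1]/(h * 1) mulr1 -(flat_mulX S h).
    by rewrite -[RHS]/(h^-1 * (h * flat (S * 'X) h)) mulKf.
  apply: DeriveDef; first by apply/cvg_ex; exists 0.
  rewrite flat_le0//; exact/cvg_lim.
Unshelve. all: by end_near. Qed.


Lemma flatD S T y : flat (S + T) y = flat S y + flat T y.
Proof. by rewrite /flat; case: ifPn => _; rewrite ?addr0// hornerD mulrDl. Qed.

(** Here 1/y tends to 0 and the exponential to 1. Thus [S.[0]] is the plateau value of the rescaled
    cutoff at a fixed interior point. *)
Lemma flat_cvgy S : flat S y @[y --> +oo] --> S.[0].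
Proof.
apply: (@cvg_trans _ (S.[y^-1] * expR (- y^-1) @[y --> +oo])).
  by apply: near_eq_cvg; near=> y; rewrite flat_gt0.
have h : y^-1 @[y --> +oo] --> (0 : R).
  apply/(@gtr0_cvgV0 _ _ _ _ id); last exact: cvg_id.
  by near=> y.
have -> : S.[0] = S.[0] * expR (- 0) by rewrite oppr0 expR0 mulr1.
apply: cvgM.
  by apply: cvg_comp h _; exact: continuous_horner.
apply: (@cvg_comp _ _ _ (fun y : R => - y^-1) expR _ (nbhs (- 0 : R))); last exact: continuous_expR.
by apply: cvgN; exact: h.
Unshelve. all: by end_near. Qed.

Definition euler_step S : {poly R} := (1 + 'X) * ('X * (S - S^`()%R)).

(** Forces every term in which a cutoff factor has been differentiated to converge to 0. *)
Lemma euler_step0 S : (euler_step S).[0] = 0.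
Proof. by rewrite /euler_step !hornerM hornerX mul0r mulr0. Qed.

(* The flat functions are graded by S, so that in the variable y = k x - 1 the
   Euler derivation x d/dx acts with coefficients independent of the scale k. *)
Lemma flat_euler S y : (y + 1) * flat (flat_step S) y = flat (euler_step S) y.
Proof.
rewrite mulrDl mul1r.
have -> : flat_step S = ('X * (S - S^`()%R)) * 'X by rewrite /flat_step; ring.
rewrite flat_mulX -flatD; congr flat; rewrite /euler_step; ring.
Qed.

Lemma poly_bounded01 P : exists2 C, 0 <= C & forall x, 0 <= x <= 1 -> `|P.[x]| <= C.
Proof.
exists (\sum_(i < size P) `|P`_i|) => [|x /andP[x0 x1]].
  by apply: sumr_ge0.
rewrite horner_coef (le_trans (ler_norm_sum _ _ _))//.
apply: ler_sum => i _; rewrite normrM ler_piMr// normrX ger0_norm//.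
exact: exprn_ile1.
Qed.

(** The factor x (1 - x) is what separates rho (a+1) (b+1) from rho a b, so this derivation is the
    one that differentiation induces between the two weights. *)
Definition theta P : {poly R} := 'X * (1 - 'X) * P^`()%R.

(* Families of smooth functions supported in [1/(n+1), 1 - 1/(n+1)] converging
   boundedly to a polynomial, and stable under x (1 - x) d/dx. *)
Inductive cutoff_family : (nat -> R -> R) -> {poly R} -> Prop :=
| cutoff_term P S T : cutoff_family
    (fun n x => P.[x] * flat S (n.+1%:R * x - 1) * flat T (n.+1%:R * (1 - x) - 1))
    ((S.[0] * T.[0]) *: P)
| cutoff_add F G L M : cutoff_family F L -> cutoff_family G M ->
    cutoff_family (fun n x => F n x + G n x) (L + M).

Lemma cutoff_exists L : exists F, cutoff_family F L.
Proof.
have := cutoff_term L 1 1; rewrite hornerC mulr1 scale1r => h.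
by eexists; exact: h.
Qed.

Lemma cutoff_family_eq F G L M : cutoff_family F L ->
  (forall n x, F n x = G n x) -> L = M -> cutoff_family G M.
Proof.
move=> FL FG <-; suff <- : F = G by [].
by apply/funext => n; apply/funext => x.
Qed.

Lemma cutoff_mul F L M : cutoff_family F L ->
  cutoff_family (fun n x => M.[x] * F n x) (M * L).
Proof.
elim=> [P S T|{}F G {}L L' _ h1 _ h2].
  apply: cutoff_family_eq (cutoff_term (M * P) S T) _ _ => [n x|].
    by rewrite hornerM !mulrA.
  by rewrite scalerAr.
apply: cutoff_family_eq (cutoff_add h1 h2) _ _ => [n x|]; first by rewrite mulrDr.
by rewrite mulrDr.
Qed.

(** The product rule gives three terms. In the two that differentiate a cutoff, [flat_euler] absorbs
    the scale n + 1, and their limits vanish by [euler_step0]; only [theta] of the polynomial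
    survives. *)
Lemma cutoff_theta F L : cutoff_family F L ->
  exists2 G, cutoff_family G (theta L) &
  forall n x, exists2 d, is_derive x 1 (F n) d & x * (1 - x) * d = G n x.
Proof.
elim=> [P S T|{}F F' {}L L' _ [G1 hG1 h1] _ [G2 hG2 h2]].
  have hA := cutoff_term (theta P) S T.
  have hB := cutoff_term ((1 - 'X) * P) (euler_step S) T.
  have hC := cutoff_term (- 'X * P) S (euler_step T).
  exists (fun n x =>
    (theta P).[x] * flat S (n.+1%:R * x - 1) * flat T (n.+1%:R * (1 - x) - 1)
    + ((1 - 'X) * P).[x] * flat (euler_step S) (n.+1%:R * x - 1) * flat T (n.+1%:R * (1 - x) - 1)
    + (- 'X * P).[x] * flat S (n.+1%:R * x - 1) * flat (euler_step T) (n.+1%:R * (1 - x) - 1)).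
    apply: cutoff_family_eq (cutoff_add (cutoff_add hA hB) hC) _ _ => //.
    rewrite !euler_step0 !(mul0r, mulr0) !scale0r !addr0.
    by rewrite /theta derivZ scalerAr.
  move=> n x; set k : R := n.+1%:R.
  have d1 : is_derive x 1 (fun z => flat S (k * z - 1)) (flat (flat_step S) (k * x - 1) * k).
    have dl : is_derive x 1 (fun z : R => k * z - 1) k.
      exact: is_derive_affine.
    exact: (@is_derive1_comp _ (flat S) _ _ _ _ (is_derive_flat _ _) dl).
  have d2 : is_derive x 1 (fun z => flat T (k * (1 - z) - 1)) (flat (flat_step T) (k * (1 - x) - 1) * - k).
    have dl : is_derive x 1 (fun z : R => k * (1 - z) - 1) (- k).
      rewrite (_ : (fun z => _) = (fun z => - k * z + (k - 1))); first exact: is_derive_affine.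
      by apply/funext => z; ring.
    exact: (@is_derive1_comp _ (flat T) _ _ _ _ (is_derive_flat _ _) dl).
  eexists; first exact: is_derive_mul (is_derive_mul (is_derive_poly P x) d1) d2.
  rewrite -!flat_euler /theta !hornerM !hornerD !hornerN !hornerX !hornerC; ring.
exists (fun n x => G1 n x + G2 n x).
  apply: cutoff_family_eq (cutoff_add hG1 hG2) _ _ => //.
  by rewrite /theta derivD -mulrDr.
move=> n x; have [d dF <-] := h1 n x; have [e dF' <-] := h2 n x.
exists (d + e); first exact: is_deriveD.
by rewrite mulrDr.
Qed.

Lemma cutoff_support F L n x : cutoff_family F L ->
  (n.+1%:R * x <= 1) || (n.+1%:R * (1 - x) <= 1) -> F n x = 0.
Proof.
move=> FL h; elim: FL => [P S T|{}F G {}L M _ -> _ ->]; last by rewrite addr0.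
by case/orP: h => h; [rewrite [flat S _]flat_le0 ?subr_le0// mulr0 mul0r|
   rewrite [flat T _]flat_le0 ?subr_le0// mulr0].
Qed.

Lemma cutoff_bounded F L : cutoff_family F L ->
  exists2 C, 0 <= C & forall n x, 0 <= x <= 1 -> `|F n x| <= C.
Proof.
elim=> [P S T|{}F G {}L M _ [C C0 hC] _ [D D0 hD]].
  have [C C0 hC] := poly_bounded01 P.
  have [D D0 hD] := flat_bounded S.
  have [E E0 hE] := flat_bounded T.
  exists (C * D * E) => [|n x x01]; first by rewrite !mulr_ge0.
  by rewrite !normrM !ler_pM ?mulr_ge0// hC.
exists (C + D) => [|n x x01]; first by rewrite addr_ge0.
by rewrite (le_trans (ler_normD _ _))// lerD ?hC ?hD.
Qed.

Lemma cutoff_cvg F L x : cutoff_family F L -> 0 < x < 1 ->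
  F n x @[n --> \oo] --> L.[x].
Proof.
move=> FL /andP[x0 x1]; elim: FL => [P S T|{}F G {}L M _ h1 _ h2]; last first.
  by rewrite hornerD; exact: cvgD.
have hf U (y : R) : 0 < y -> flat U (n.+1%:R * y - 1) @[n --> \oo] --> U.[0].
  move=> y0; apply: (@cvg_comp _ _ _ (fun n => n.+1%:R * y - 1) (flat U) _ (+oo)); last exact: flat_cvgy.
  apply/cvgryPge => A; near=> n.
  rewrite lerBrDr -ler_pdivrMr// -natr1.
  have : (A + 1) / y <= n%:R by near: n; exact: nbhs_infty_ger.
  lra.
rewrite hornerZ mulrC mulrA; apply: cvgM.
  by apply: cvgM; [exact: cvg_cst|exact: hf].
by apply: hf; rewrite subr_gt0.
Unshelve. all: by end_near. Qed.

End FlatFunctions.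

(** * Weights multiplied by cutoffs *)

Section Weights.
Variable R : realType.
Implicit Types (a b x : R) (L P : {poly R}).
Local Notation mu := (@lebesgue_measure R).
Local Notation I01 := (`]0%R, 1%R[%classic : set R).

Lemma in01 x : I01 x -> 0 < x < 1.
Proof. by rewrite /= in_itv. Qed.

Lemma rho_gt0 a b x : 0 < x < 1 -> 0 < rho a b x.
Proof. by move=> /andP[x0 x1]; rewrite mulr_gt0 ?powR_gt0 ?subr_gt0. Qed.

Lemma rho_ge0 a b x : 0 <= rho a b x.
Proof. by rewrite mulr_ge0 ?powR_ge0. Qed.

Lemma rhoD a b c d x : 0 < x < 1 -> rho (a + c) (b + d) x = rho a b x * rho c d x.
Proof.
move=> /andP[x0 x1]; rewrite /rho !powRD; first ring.
all: by apply/implyP => _; rewrite gt_eqF ?subr_gt0.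
Qed.

Lemma rho11 x : 0 < x < 1 -> rho 1 1 x = x * (1 - x).
Proof.
by move=> /andP[x0 x1]; rewrite /rho !powRr1 ?(ltW x0)// ?subr_ge0 ?ltW// mulrC.
Qed.

Lemma measurable_rho a b (D : set (measurableTypeR R)) : measurable_fun D (rho a b).
Proof.
apply: (@measurable_funS _ _ _ _ setT) => //.
apply: measurable_funM.
  apply: (measurableT_comp (@measurable_powR R a)).
  exact: measurable_funB.
exact: measurable_powR.
Qed.

Lemma is_derive_rho a b x : 0 < x < 1 ->
  is_derive x 1 (rho (a + 1) (b + 1)) (rho a b x * ((b + 1) * (1 - x) - (a + 1) * x)).
Proof.
move=> x01; have /andP[x0 x1] := x01; have y0 : 0 < 1 - x by rewrite subr_gt0.
have d1 : is_derive x 1 (fun z => (1 - z) `^ (a + 1)) ((a + 1) * (1 - x) `^ a * (-1)).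
  have dl : is_derive x 1 (fun z : R => 1 - z) (-1).
    rewrite (_ : (fun z => _) = (fun z => -1 * z + 1)); first exact: is_derive_affine.
    by apply/funext => z; ring.
  have := @is_derive1_comp _ (fun z => z `^ (a + 1)) _ x _ _ (is_derive1_powR (a + 1) y0) dl.
  by rewrite addrK.
have d2 : is_derive x 1 (fun z => z `^ (b + 1)) ((b + 1) * x `^ b).
  by have := is_derive1_powR (b + 1) x0; rewrite addrK.
apply: is_derive_eq (is_derive_mul d1 d2) _.
have pow1 c z : 0 < z -> z `^ (c + 1) = z `^ c * z.
  by move=> z0; rewrite powRD ?(gt_eqF z0) ?implybT// powRr1// ltW.
rewrite /rho !pow1//; ring.
Qed.

(* D (rho (a+1) (b+1) P) = rho a b (rho_deriv a b P) *)
Definition rho_deriv a b P : {poly R} :=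
  ((b + 1) *: (1 - 'X) - (a + 1) *: 'X) * P + theta P.

(** The quotient of D^j (rho (a+j) (b+j) P) by rho a b, as in Rodrigues formulas: each derivative
    lowers both exponents by one. *)
Fixpoint rho_derivn (j : nat) a b P : {poly R} :=
  if j is i.+1 then rho_deriv a b (rho_derivn i (a + 1) (b + 1) P) else P.

Lemma cutoff_rho_deriv F L a b : cutoff_family F L ->
  exists2 G, cutoff_family G (rho_deriv a b L) &
  forall n x, is_derive x 1 (fun z => rho (a + 1) (b + 1) z * F n z) (rho a b x * G n x).
Proof.
move=> FL; have [G GL FG] := cutoff_theta FL.
set M := (b + 1) *: (1 - 'X) - (a + 1) *: 'X.
have MGL := cutoff_add (cutoff_mul M FL) GL.
exists (fun n x => M.[x] * F n x + G n x) => // n x.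
(* Closer to an endpoint than 1/(n+1), or outside (0, 1), the product vanishes on a neighbourhood of
   x, so the singular powers need not be differentiated there. *)
have [h|/norP[]] := boolP ((n.+1%:R * x < 1) || (n.+1%:R * (1 - x) < 1)).
  rewrite (cutoff_support MGL); last by case/orP: h => /ltW ->; rewrite ?orbT.
  apply: (@near_eq_is_derive _ _ _ (cst 0)); last by apply: is_derive_eq; rewrite mulr0.
  case/orP: h => h; near=> z; rewrite (cutoff_support FL) ?mulr0//; apply/orP; [left|right].
    rewrite mulrC -ler_pdivlMr ?ltr0Sn//; apply: ltW; near: z; apply: lt_nbhsl.
    by rewrite ltr_pdivlMr ?ltr0Sn// mulrC.
  rewrite mulrC -ler_pdivlMr ?ltr0Sn// lerBlDl -lerBlDr; apply: ltW; near: z; apply: lt_nbhsr.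
  by rewrite ltrBlDr -ltrBlDl ltr_pdivlMr ?ltr0Sn// mulrC.
rewrite -!leNgt => h1 h2.
have x01 : 0 < x < 1.
  apply/andP; split; first by rewrite -(pmulr_rgt0 _ (ltr0Sn R n)) (lt_le_trans _ h1).
  by rewrite -subr_gt0 -(pmulr_rgt0 _ (ltr0Sn R n)) (lt_le_trans _ h2).
have [d dF <-] := FG n x.
apply: is_derive_eq (is_derive_mul (is_derive_rho a b x01) dF) _.
rewrite rhoD// rho11// /M hornerD hornerN !hornerZ hornerD hornerN hornerX hornerC; ring.
Unshelve. all: by end_near. Qed.

Lemma cutoff_rho_derivn j F L a b : cutoff_family F L ->
  exists2 G, cutoff_family G (rho_derivn j a b L) &
  forall n, derive1n j (fun z => rho (a + j%:R) (b + j%:R) z * F n z)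
    = (fun x => rho a b x * G n x).
Proof.
move=> FL; elim: j a b => [|j IH] a b.
  by exists F => // n; rewrite !addr0.
have [G GL FG] := IH (a + 1) (b + 1).
have [H HL GH] := cutoff_rho_deriv a b GL.
exists H => // n.
rewrite derive1nS -natr1 !(addrC _ 1) !addrA FG.
by apply/funext => x; rewrite derive1E; have [_ ->] := GH n x.
Qed.

Lemma cutoff_derivable F L a b n x : cutoff_family F L ->
  derivable (fun z => rho a b z * F n z) x 1.
Proof.
move=> FL; have [G GL] := cutoff_rho_deriv (a - 1) (b - 1) FL.
by rewrite !subrK => /(_ n x)[].
Qed.

(** Arbitrary real exponents are allowed because the support avoids 0 and 1. The m-th derivative
    comes from [cutoff_rho_derivn] at exponents lowered by m. *)
Lemma cutoff_test F L a b n : cutoff_family F L ->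
  test_function (fun z => rho a b z * F n z).
Proof.
move=> FL; split=> [m x|].
  have [G GL] := cutoff_rho_derivn m (a - m%:R) (b - m%:R) FL.
  by rewrite !subrK => ->; exact: cutoff_derivable GL.
exists `[n.+1%:R^-1, 1 - n.+1%:R^-1]%classic; split.
- exact: segment_compact.
- have n0 : 0 < n.+1%:R^-1 :> R by rewrite invr_gt0.
  move=> x /=; rewrite !in_itv/= => /andP[x1 x2]; apply/andP.
  by move: (n.+1%:R^-1) n0 x1 x2 => c c0 x1 x2; split; lra.
- move=> x /= /negP; rewrite in_itv/= negb_and -!ltNge => h.
  rewrite (cutoff_support FL) ?mulr0//; apply/orP.
  rewrite -!ler_pdivlMl ?ltr0Sn// !mulr1.
  by move: (n.+1%:R^-1) h => c /orP[] h; [left|right]; lra.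
Qed.

End Weights.

(** * Integration over the open unit interval *)

Section UnitInterval.
Variable R : realType.
Implicit Types (a b x k : R) (f g h phi : R -> R).
Local Notation mu := (@lebesgue_measure R).
Local Notation I01 := (`]0%R, 1%R[%classic : set (measurableTypeR R)).

Definition itg f := mu.-integrable I01 (EFin \o f).
Definition int01 f : R := \int[mu]_(x in I01) f x.

Lemma measurable_I01 : measurable I01.
Proof. exact: measurable_itv. Qed.
Hint Resolve measurable_I01 : core.

Lemma itg_measurable f : itg f -> measurable_fun I01 f.
Proof. by move=> /integrableP[] /measurable_EFinP. Qed.

Lemma itg_eq f g : (forall x, 0 < x < 1 -> f x = g x) -> itg f -> itg g.
Proof.
move=> fg; apply: eq_integrable => // x /set_mem /in01 x01.
by rewrite /= fg.
Qed.

Lemma int01_eq f g : (forall x, 0 < x < 1 -> f x = g x) -> int01 f = int01 g.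
Proof. by move=> fg; apply: eq_Rintegral => x /set_mem /in01; exact: fg. Qed.

Lemma itg0 : itg (fun=> 0).
Proof. exact: integrable0. Qed.

Lemma itgD f g : itg f -> itg g -> itg (fun x => f x + g x).
Proof. by move=> hf hg; exact: (integrableD measurable_I01 hf hg). Qed.

Lemma itgZ k f : itg f -> itg (fun x => k * f x).
Proof. by move=> hf; exact: (integrableZl measurable_I01 k hf). Qed.

Lemma itgB f g : itg f -> itg g -> itg (fun x => f x - g x).
Proof. by move=> hf hg; exact: (integrableB measurable_I01 hf hg). Qed.

Lemma itg_sum n (F : nat -> R -> R) : (forall i, (i < n)%N -> itg (F i)) ->
  itg (fun x => \sum_(i < n) F i x).
Proof.
elim: n => [_|n IH h].
  by apply: itg_eq itg0 => x _; rewrite big_ord0.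
have := itgD (IH (fun i hi => h i (ltnW hi))) (h n (leqnn _)).
by apply: itg_eq => x _; rewrite big_ord_recr.
Qed.

Lemma int01D f g : itg f -> itg g -> int01 (fun x => f x + g x) = int01 f + int01 g.
Proof. by move=> ? ?; exact: RintegralD. Qed.

Lemma int01B f g : itg f -> itg g -> int01 (fun x => f x - g x) = int01 f - int01 g.
Proof. by move=> ? ?; exact: RintegralB. Qed.

Lemma int01Z k f : itg f -> int01 (fun x => k * f x) = k * int01 f.
Proof. by move=> ?; exact: RintegralZl. Qed.

Lemma int01_cst0 : int01 (fun=> 0) = 0.
Proof. by rewrite /int01 Rintegral_cst// mul0r. Qed.

Lemma int01_sum n (F : nat -> R -> R) : (forall i, (i < n)%N -> itg (F i)) ->
  int01 (fun x => \sum_(i < n) F i x) = \sum_(i < n) int01 (F i).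
Proof.
elim: n => [_|n IH h].
  by rewrite big_ord0 -[RHS]int01_cst0; apply: int01_eq => x _; rewrite big_ord0.
have h' i : (i < n)%N -> itg (F i) by move=> hi; apply: h; exact: ltnW.
rewrite big_ord_recr/= -IH// -int01D ?h//; last exact: itg_sum.
by apply: int01_eq => x _; rewrite big_ord_recr.
Qed.

Lemma int01_ge0 f : (forall x, 0 < x < 1 -> 0 <= f x) -> 0 <= int01 f.
Proof. by move=> f0; apply: Rintegral_ge0 => x /in01; exact: f0. Qed.

Lemma le_int01 f g : itg f -> itg g -> (forall x, 0 < x < 1 -> f x <= g x) ->
  int01 f <= int01 g.
Proof. by move=> ? ? fg; apply: le_Rintegral => // x /in01; exact: fg. Qed.

Lemma le_itg f g : measurable_fun I01 f -> (forall x, 0 < x < 1 -> `|f x| <= g x) ->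
  itg g -> itg f.
Proof.
move=> mf fg; apply: le_integrable => //; first exact/measurable_EFinP.
move=> x /in01 x01 /=; rewrite lee_fin (le_trans (fg _ x01))//; exact: ler_norm.
Qed.

Lemma itg_norm f : itg f -> itg (fun x => `|f x|).
Proof. exact: integrable_norm. Qed.

Lemma itgM_bounded f g C : itg f -> measurable_fun I01 g ->
  (forall x, 0 < x < 1 -> `|g x| <= C) -> itg (fun x => f x * g x).
Proof.
move=> itf mg gC; apply: (@le_itg _ (fun x => C * `|f x|)).
- by apply: measurable_funM => //; exact: itg_measurable.
- by move=> x x01; rewrite normrM mulrC ler_wpM2r// gC.
- by apply: itgZ; exact: itg_norm.
Qed.

Lemma int01_dominated (F : nat -> R -> R) f g :
  (forall n, measurable_fun I01 (F n)) -> itg g ->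
  (forall n x, 0 < x < 1 -> `|F n x| <= g x) ->
  (forall x, 0 < x < 1 -> F n x @[n --> \oo] --> f x) ->
  itg f /\ int01 (F n) @[n --> \oo] --> int01 f.
Proof.
move=> mF itg_g Fg Ff.
have mf : measurable_fun I01 f.
  by apply: (measurable_fun_cvg mF) => x /in01; exact: Ff.
have [] := @dominated_convergence _ _ _ mu I01 measurable_I01
  (fun n => EFin \o F n) (EFin \o f) (EFin \o g).
- by move=> n; exact/measurable_EFinP.
- exact/measurable_EFinP.
- by apply: aeW => x /in01 x01; apply/fine_cvgP; split; [exact: nearW|exact: Ff].
- exact: itg_g.
- by apply: aeW => x n /in01 x01; rewrite lee_fin Fg.
move=> itf _ cvF; split => //.
by apply: fine_cvg; rewrite fineK//; exact: integrable_fin_num itf.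
Qed.

Lemma itg_continuous f : continuous f -> itg f.
Proof.
move=> cf; apply: (@integrableS _ _ _ mu (`[0%R, 1%R]%classic : set (measurableTypeR R))) => //.
  exact: subset_itv_oo_cc.
apply: continuous_compact_integrable; first exact: segment_compact.
exact: continuous_subspaceT.
Qed.

Lemma continuous_measurable01 f : continuous f -> measurable_fun I01 f.
Proof. by move=> /itg_continuous/itg_measurable. Qed.

Lemma derivable_continuous f : (forall x, derivable f x 1) -> continuous f.
Proof. by move=> df x; apply/differentiable_continuous/derivable1_diffP. Qed.

Lemma int01_derive_eq0 phi : (forall x, derivable phi x 1) -> continuous (derive1 phi) ->
  phi 0 = 0 -> phi 1 = 0 -> int01 (derive1 phi) = 0.
Proof.
move=> dphi cphi' p0 p1; rewrite /int01 /Rintegral -(integral_itv_bndoo true false); last first.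
  by apply/measurable_EFinP; exact: continuous_measurable01.
rewrite (@continuous_FTC2 _ _ phi) ?ltr01//.
- by rewrite p0 p1 -EFinB subrr.
- exact: continuous_subspaceT.
- have cphi := derivable_continuous dphi.
  by split => [x _ //||]; [apply: cvg_at_right_filter|apply: cvg_at_left_filter]; exact: cphi.
Qed.

(** On each compact subinterval the integral is an increment of [F], hence at most 2 C; monotone
    convergence extends the bound to (0, 1). *)
Lemma itg_ge0_primitive f F C : measurable_fun I01 f ->
  (forall x, 0 < x < 1 -> 0 <= f x) ->
  (forall x, 0 < x < 1 -> {for x, continuous f}) ->
  (forall x, 0 < x < 1 -> is_derive x 1 F (f x)) ->
  (forall x, 0 < x < 1 -> `|F x| <= C) -> itg f.
Proof.
move=> mf f0 cf dF FC.
(* The offset 3 makes 1/(n+3) < 1 - 1/(n+3) already for n = 0. *)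
pose E n : set (measurableTypeR R) := `[n.+3%:R^-1, 1 - n.+3%:R^-1]%classic.
have n01 n : 0 < n.+3%:R^-1 :> R by rewrite invr_gt0.
have n13 n : n.+3%:R^-1 <= 3^-1 :> R by rewrite lef_pV2 ?posrE// ler_nat.
have EI n x : E n x -> 0 < x < 1.
  rewrite /E /= in_itv/= => /andP[]; move: (n01 n) (n13 n).
  by move: (n.+3%:R^-1) => c; lra.
have UE : \bigcup_n E n = I01.
  apply/seteqP; split => [x [n _ /EI]|x /in01/andP[x0 x1]]; first by rewrite /= in_itv.
  have m0 : 0 < Num.min x (1 - x) by rewrite lt_min x0 subr_gt0.
  pose N := Num.truncn (Num.min x (1 - x))^-1.
  have : (Num.min x (1 - x))^-1 < N.+1%:R by rewrite truncnS_gt.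
  move=> hN; have {}hN : (Num.min x (1 - x))^-1 <= N.+3%:R.
    by apply: (le_trans (ltW hN)); rewrite ler_nat; apply: leqW.
  have : N.+3%:R^-1 <= Num.min x (1 - x).
    by rewrite -[leRHS]invrK lef_pV2 ?posrE ?invr_gt0.
  rewrite le_min => /andP[h1 h2].
  by exists N => //; rewrite /E /= in_itv/= h1/= lerBrDr -lerBrDl.
have mE n : measurable (E n) by exact: measurable_itv.
have mfE n : measurable_fun (E n) (EFin \o f).
  apply: (measurable_funS measurable_I01); first by rewrite -UE; exact: bigcup_sup.
  exact/measurable_EFinP.
have ndE : nondecreasing_seq E.
  move=> n m nm; apply/subsetPset => x; rewrite /E /= !in_itv/= => /andP[h1 h2].
  have : m.+3%:R^-1 <= n.+3%:R^-1 :> R by rewrite lef_pV2 ?posrE// ler_nat.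
  by move: (m.+3%:R^-1) (n.+3%:R^-1) h1 h2 => c d; lra.
have intE n : (\int[mu]_(x in E n) (EFin \o f) x <= (2 * C)%:E)%E.
  have lt3 : n.+3%:R^-1 < 1 - n.+3%:R^-1 :> R.
    by move: (n01 n) (n13 n); move: (n.+3%:R^-1) => c; lra.
  have in1 : 0 < (n.+3%:R^-1 : R) < 1.
    by move: (n01 n) (n13 n); move: (n.+3%:R^-1) => c; lra.
  have in2 : 0 < (1 - n.+3%:R^-1 : R) < 1.
    by move: (n01 n) (n13 n); move: (n.+3%:R^-1) => c; lra.
  have cF x : 0 < x < 1 -> {for x, continuous F}.
    by move=> /dF[dFx _]; apply/differentiable_continuous/derivable1_diffP.
  have sub x : x \in `]n.+3%:R^-1, 1 - n.+3%:R^-1[ -> 0 < x < 1.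
    rewrite in_itv/= => /andP[]; move: (n01 n) (n13 n); move: (n.+3%:R^-1) => c; lra.
  rewrite (@continuous_FTC2 _ _ F)//.
  - rewrite -EFinB lee_fin; have := FC _ in1; have := FC _ in2.
    rewrite !ler_norml => /andP[_ h1] /andP[h2 _].
    by move: (F _) (F _) h1 h2 => u v h1 h2; lra.
  - by apply: continuous_in_subspaceT => x /set_mem /EI; exact: cf.
  - split => [x /sub /dF[]//||]; [apply: cvg_at_right_filter|apply: cvg_at_left_filter]; exact: cF.
  - by move=> x /sub /dF[_ h]; rewrite derive1E.
have fE0 n x : E n x -> (0 <= (EFin \o f) x)%E by move=> /EI /f0; rewrite lee_fin.
have cvE := @ge0_nondecreasing_set_cvg_integral _ _ _ E (EFin \o f) mu ndE mE mfE fE0.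
apply/integrableP; split; first exact/measurable_EFinP.
apply: (@le_lt_trans _ _ (2 * C)%:E); last exact: ltry.
rewrite (@eq_integral _ _ _ mu I01 (EFin \o f)); last first.
  by move=> x /set_mem /in01 /f0 fx0; rewrite gee0_abs// lee_fin.
rewrite -UE -(cvg_lim _ cvE)//; apply: lime_le; last exact: nearW.
by apply/cvg_ex; eexists; exact: cvE.
Qed.

(** The image of Lebesgue measure under x -> 1 - x agrees with it on half-open intervals, hence
    everywhere. *)
Lemma int01_reflect f : measurable_fun I01 f -> (forall x, 0 < x < 1 -> 0 <= f x) ->
  int01 (fun x => f (1 - x)) = int01 f.
Proof.
move=> mf f0; rewrite /int01 /Rintegral; congr fine.
pose p : measurableTypeR R -> measurableTypeR R := fun x => 1 - x.
have mp : measurable_fun setT p by exact: measurable_funB.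
have -> : (\int[mu]_(x in I01) (f (1 - x))%:E = \int[mu]_(x in p @^-1` I01) ((EFin \o f) \o p) x)%E.
  congr integral; apply/seteqP; split => x; rewrite /p /= !in_itv/= subr_gt0 gtrBl => /andP[-> ->]//.
rewrite -(ge0_integral_pushforward mp)//; last 2 first.
  exact/measurable_EFinP.
  by move=> x /set_mem /in01 /f0; rewrite lee_fin.
apply: eq_measure_integral => A mA _.
apply/esym/lebesgue_measure_unique => //= _ [[a b]] _ <-.
rewrite /pushforward.
have -> : p @^-1` [set` `]a, b]] = `[1 - b, 1 - a[%classic.
  by apply/seteqP; split => x; rewrite /p /= !in_itv/= => /andP[]; lra.
rewrite !lebesgue_measure_itv/= !lte_fin ltrD2l ltrN2 -!EFinB.
by case: ifPn => // _; congr EFin; ring.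
Qed.

End UnitInterval.
#[global] Hint Resolve measurable_I01 : core.

(** * Integrability of the weights and removal of the cutoffs *)

Section WeightIntegrals.
Variable R : realType.
Implicit Types (a b x k : R) (f g h phi : R -> R) (P Q L : {poly R}).
Local Notation mu := (@lebesgue_measure R).
Local Notation I01 := (`]0%R, 1%R[%classic : set (measurableTypeR R)).

Lemma is_derive_primitive_powR b x : -1 < b -> 0 < x ->
  is_derive x 1 (fun z => (b + 1)^-1 * z `^ (b + 1)) (x `^ b).
Proof.
move=> b1 x0; have b10 : b + 1 != 0 by rewrite gt_eqF// -ltrBlDr sub0r.
have := is_derive_mul (is_derive_cst (b + 1)^-1 x 1) (is_derive1_powR (b + 1) x0).
by rewrite mul0r add0r addrK mulKf.
Qed.

Lemma powR_le1 b x : 0 <= b -> 0 < x <= 1 -> x `^ b <= 1.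
Proof. by move=> b0 x01; rewrite -[leRHS](powRr0 x); exact: ger_powR. Qed.

Lemma itg_powR b : -1 < b -> itg (fun x => x `^ b).
Proof.
move=> b1; have b10 : 0 < b + 1 by rewrite -ltrBlDr sub0r.
apply: (@itg_ge0_primitive _ _ (fun z => (b + 1)^-1 * z `^ (b + 1)) (b + 1)^-1).
- apply: (@measurable_funS _ _ _ _ setT) => //; exact: measurable_powR.
- by move=> x _; exact: powR_ge0.
- move=> x /andP[x0 _]; apply/differentiable_continuous/derivable1_diffP.
  by apply: derivable_powR; rewrite in_itv/= x0.
- by move=> x /andP[x0 _]; exact: is_derive_primitive_powR.
- move=> x /andP[x0 x1]; rewrite ger0_norm ?mulr_ge0 ?powR_ge0 ?invr_ge0 ?(ltW b10)//.
  rewrite ler_piMr ?invr_ge0 ?(ltW b10)//; apply: powR_le1; first exact: ltW.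
  by rewrite x0 ltW.
Qed.

Lemma itg_powR1B a : -1 < a -> itg (fun x => (1 - x) `^ a).
Proof.
move=> a1; have a10 : 0 < a + 1 by rewrite -ltrBlDr sub0r.
have d1B x : is_derive x 1 (fun z : R => 1 - z) (-1).
  rewrite (_ : (fun z => _) = (fun z => -1 * z + 1)); first exact: is_derive_affine.
  by apply/funext => z; ring.
have dpow x : 0 < x < 1 -> is_derive x 1 (fun z : R => (a + 1)^-1 * (1 - z) `^ (a + 1)) ((1 - x) `^ a * -1).
  move=> /andP[x0 x1]; have y0 : 0 < 1 - x by rewrite subr_gt0.
  exact: (@is_derive1_comp _ _ (fun z => 1 - z) x _ _ (is_derive_primitive_powR a1 y0) (d1B x)).
apply: (@itg_ge0_primitive _ _ (fun z => -1 * ((a + 1)^-1 * (1 - z) `^ (a + 1))) (a + 1)^-1).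
- apply: (measurableT_comp (@measurable_powR R a)).
  exact: measurable_funB.
- by move=> x _; exact: powR_ge0.
- move=> x /andP[x0 x1]; have y0 : 0 < 1 - x by rewrite subr_gt0.
  apply/differentiable_continuous/derivable1_diffP.
  have [] := (@is_derive1_comp _ _ (fun z => 1 - z) x _ _ (is_derive1_powR a y0) (d1B x)).
  by [].
- move=> x x01.
  have := is_derive_mul (is_derive_cst (-1 : R) x 1) (dpow _ x01).
  by rewrite mul0r add0r mulN1r mulrN1 opprK.
- move=> x /andP[x0 x1]; have y0 : 0 < 1 - x by rewrite subr_gt0.
  rewrite mulN1r normrN ger0_norm ?mulr_ge0 ?powR_ge0 ?invr_ge0 ?(ltW a10)//.
  rewrite ler_piMr ?invr_ge0 ?(ltW a10)//; apply: powR_le1; first exact: ltW.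
  by rewrite y0 gerBl ltW.
Qed.

(** The term 1 serves for a >= 0 and 2^(-a) for a < 0; their sum covers both signs. *)
Lemma powR_le_half a y : 2^-1 <= y <= 1 -> y `^ a <= 1 + 2 `^ (- a).
Proof.
move=> /andP[y2 y1]; have y0 : 0 < y by apply: lt_le_trans y2.
have [a0|a0] := leP 0 a.
  rewrite (le_trans (powR_le1 a0 _)) ?y0// lerDl; exact: powR_ge0.
have -> : y `^ a = y^-1 `^ (- a).
  by rewrite -(powR_inv1 (ltW y0)) -powRrM mulN1r opprK.
rewrite -[leLHS]add0r lerD//.
apply: ge0_ler_powR; rewrite ?nnegrE ?invr_ge0 ?(ltW y0)//.
  by rewrite oppr_ge0 ltW.
by rewrite -[leRHS]invrK lef_pV2 ?posrE.
Qed.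

(** Left of 1/2 the power of 1 - x is bounded, right of 1/2 the power of x, so a sum of two
    one-sided powers dominates. *)
Lemma itg_rho a b : -1 < a -> -1 < b -> itg (rho a b).
Proof.
move=> a1 b1.
have ig := itgD (itgZ (1 + 2 `^ (- a)) (itg_powR b1)) (itgZ (1 + 2 `^ (- b)) (itg_powR1B a1)).
apply: le_itg ig; first exact: measurable_rho.
move=> x /andP[x0 x1]; rewrite ger0_norm ?rho_ge0// /rho.
have [h|h] := leP x 2^-1.
  rewrite -[leLHS]addr0 lerD ?mulr_ge0 ?powR_ge0 ?addr_ge0 ?powR_ge0//.
  apply: ler_wpM2r; first exact: powR_ge0.
  by apply: powR_le_half; lra.
rewrite -[leLHS]add0r lerD ?mulr_ge0 ?powR_ge0 ?addr_ge0 ?powR_ge0//.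
rewrite mulrC ler_wpM2r ?powR_ge0//.
by apply: powR_le_half; lra.
Qed.

Lemma measurable_horner P (D : set (measurableTypeR R)) : measurable_fun D (horner P).
Proof.
apply: (@measurable_funS _ _ _ _ setT) => //.
by apply: continuous_measurable_fun; exact: continuous_horner.
Qed.

Lemma itgM_poly f P : itg f -> itg (fun x => f x * P.[x]).
Proof.
move=> itf; have [C C0 hC] := poly_bounded01 P.
apply: (@itgM_bounded _ f (horner P) C itf (@measurable_horner P _)) => x /andP[x0 x1].
by apply: hC; rewrite !ltW.
Qed.

Lemma itg_rho_poly a b P : -1 < a -> -1 < b -> itg (fun x => rho a b x * P.[x]).
Proof. by move=> a1 b1; apply: itgM_poly; exact: itg_rho. Qed.

Lemma cutoff_measurable F L n : cutoff_family F L -> measurable_fun I01 (F n).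
Proof.
move=> FL; have [G _ FG] := cutoff_theta FL.
apply: continuous_measurable01; apply: derivable_continuous => x.
by have [d []] := FG n x.
Qed.

Lemma int01_cutoff F L f : cutoff_family F L -> itg f ->
  int01 (fun x => f x * F n x) @[n --> \oo] --> int01 (fun x => f x * L.[x]).
Proof.
move=> FL itf; have [C C0 hC] := cutoff_bounded FL.
apply: (@int01_dominated _ (fun n x => f x * F n x) _ (fun x => C * `|f x|) _ _ _ _).2.
- move=> n; apply: measurable_funM; first exact: itg_measurable.
  exact: cutoff_measurable FL.
- by apply: itgZ; exact: itg_norm.
- move=> n x /andP[x0 x1]; rewrite normrM mulrC ler_wpM2r//.
  by apply: hC; rewrite !ltW.
- by move=> x x01; apply: cvgM; [exact: cvg_cst|exact: cutoff_cvg FL x01].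
Qed.

(** In general rho (a+j) (b+j) P is not a test function, but its cutoffs are; the bounds uniform in
    n allow dominated convergence on both sides of the tested identity. *)
Lemma weak_derivative_rho (j : nat) f g a b P : weak_derivative j f g ->
  itg (fun x => rho a b x * f x) ->
  itg (fun x => rho (a + j%:R) (b + j%:R) x * g x) ->
  int01 (fun x => rho a b x * f x * (rho_derivn j a b P).[x]) =
  (-1) ^+ j * int01 (fun x => rho (a + j%:R) (b + j%:R) x * g x * P.[x]).
Proof.
move=> [_ _ fg] itf itg_g.
have [F FP] := cutoff_exists P.
have [G GP FG] := cutoff_rho_derivn j a b FP.
have c1 := int01_cutoff GP itf.
have c2 : (-1) ^+ j * int01 (fun x => rho (a + j%:R) (b + j%:R) x * g x * F n x) @[n --> \oo]
    --> (-1) ^+ j * int01 (fun x => rho (a + j%:R) (b + j%:R) x * g x * P.[x]).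
  by apply: cvgM; [exact: cvg_cst|exact: int01_cutoff].
apply: (cvg_unique (@norm_hausdorff _ R) c1).
apply: cvg_trans c2; apply: near_eq_cvg; apply: nearW => n.
transitivity ((-1) ^+ j * int01 (fun x => g x * (rho (a + j%:R) (b + j%:R) x * F n x))).
  by congr (_ * _); apply: int01_eq => x _; ring.
rewrite /int01 -(fg _ (cutoff_test _ _ n FP)) FG.
by apply: int01_eq => x _; ring.
Qed.

(** The integrand is the derivative of rho (a+1) (b+1) P, and the cutoff version of that product
    vanishes at 0 and 1. *)
Lemma int01_rho_deriv a b P : -1 < a -> -1 < b ->
  int01 (fun x => rho a b x * (rho_deriv a b P).[x]) = 0.
Proof.
move=> a1 b1; have [F FP] := cutoff_exists P.
have [G GP FG] := cutoff_rho_deriv a b FP.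
have c1 := int01_cutoff GP (itg_rho a1 b1).
apply: (cvg_unique (@norm_hausdorff _ R) c1).
apply: (@cvg_trans _ ((fun=> (0 : R)) @ \oo)); last exact: cvg_cst.
apply: near_eq_cvg; apply: nearW => n.
have dE : derive1 (fun z => rho (a + 1) (b + 1) z * F n z) = (fun x => rho a b x * G n x).
  by apply/funext => x; rewrite derive1E; have [_ ->] := FG n x.
apply/esym; rewrite -dE; apply: int01_derive_eq0.
- by move=> x; exact: cutoff_derivable FP.
- by rewrite dE; apply: derivable_continuous => x; exact: cutoff_derivable GP.
- by rewrite (cutoff_support FP) ?mulr0 ?ler01.
- by rewrite (cutoff_support FP) ?subrr ?mulr0 ?ler01 ?orbT.
Qed.

End WeightIntegrals.

(** * Algebra of shifted Jacobi polynomials *)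

Section JacobiPolynomials.
Variable R : realType.
Implicit Types (a b x y z : R) (f g h phi : R -> R) (P Q L : {poly R}).
Local Notation mu := (@lebesgue_measure R).
Local Notation I01 := (`]0%R, 1%R[%classic : set (measurableTypeR R)).

Lemma gbinomS z m : m.+1%:R * gbinom z m.+1 = (z - m%:R) * gbinom z m.
Proof.
rewrite /gbinom big_ord_recr/= factS natrM invfM.
have h1 : m.+1%:R != 0 :> R by rewrite pnatr_eq0.
by rewrite (mulrC _ (z - _)) -!mulrA mulrCA; congr (_ * _); rewrite mulrCA mulVKf.
Qed.

Definition shifted_jacobi (n : nat) a b : {poly R} :=
  \sum_(m < n.+1) (gbinom (n%:R + a) m * gbinom (n%:R + b) (n - m))%:P *
    (('X - 1) ^+ (n - m) * 'X ^+ m).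

Lemma GpolyE n a b x : Gpoly n a b x = (shifted_jacobi n a b).[x].
Proof.
rewrite /Gpoly /jacobi /shifted_jacobi horner_sum mulr_sumr.
apply: eq_bigr => m _.
rewrite !hornerM hornerC !horner_exp hornerD hornerN hornerX hornerC.
have -> : 2 * x - 1 - 1 = 2 * (x - 1) by ring.
have -> : 2 * x - 1 + 1 = 2 * x by ring.
have -> : (2 ^- n : R) = 2 ^- (n - m) * 2 ^- m.
  by rewrite -invfM -exprD subnK// -ltnS.
rewrite !exprMn; have h2 (k : nat) : (2 : R) ^+ k != 0 by rewrite expf_neq0.
by field; rewrite !h2.
Qed.

Lemma shifted_jacobi0 a b : shifted_jacobi 0 a b = 1.
Proof. by rewrite /shifted_jacobi big_ord1 /gbinom !big_ord0 !expr0 !divr1 !mulr1. Qed.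


Let jterm (k m : nat) : {poly R} := ('X - 1) ^+ k * 'X ^+ m.

Let deriv_sum n (F : 'I_n -> {poly R}) : (\sum_(i < n) F i)^`()%R = \sum_(i < n) (F i)^`()%R.
Proof. by apply: (big_morph (@deriv R) (@derivD R)); exact: deriv0. Qed.

Let theta_jterm k m : theta (jterm k m) =
  m%:R%:P * ((1 - 'X) * jterm k m) - k%:R%:P * ('X * jterm k m).
Proof.
have dX1 : ('X - 1 : {poly R})^`()%R = 1.
  by rewrite derivB derivX -polyC1 derivC subr0.
rewrite /theta /jterm derivM derivXn deriv_exp dX1 mul1r -[_ ^+ k.-1 *+ k]mulr_natl.
rewrite -['X ^+ m.-1 *+ m]mulr_natl !polyC_natr.
case: k => [|k]; case: m => [|m] /=; rewrite ?expr0 ?exprS ?exprS; ring.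
Qed.

(** The identity is compared after multiplication by X (1 - X), because [theta] acts simply on (X -
    1)^k X^m. By the recurrence of the binomials the m-th term gets coefficients n+1+a-m and b+1+m,
    whose sum n+a+b+2 does not depend on m. *)
Lemma shifted_jacobi_deriv n a b : (shifted_jacobi n.+1 a b)^`()%R =
  (n%:R + a + b + 2) *: shifted_jacobi n (a + 1) (b + 1).
Proof.
have X0 : 'X * (1 - 'X) != 0 :> {poly R}.
  by rewrite mulf_neq0 ?polyX_eq0// -oppr_eq0 opprB polyXsubC_eq0.
apply: (mulfI X0); rewrite -[LHS]/(theta (shifted_jacobi n.+1 a b)).
pose e m := gbinom (n.+1%:R + a) m * gbinom (n.+1%:R + b) (n.+1 - m).
have -> : theta (shifted_jacobi n.+1 a b) =
    \sum_(m < n.+2) (m%:R * e m)%:P * ((1 - 'X) * jterm (n.+1 - m) m) -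
    \sum_(m < n.+2) ((n.+1 - m)%:R * e m)%:P * ('X * jterm (n.+1 - m) m).
  rewrite /theta /shifted_jacobi deriv_sum mulr_sumr -sumrB.
  apply: eq_bigr => m _; rewrite deriv_mulC mulrCA -/(jterm _ _) -/(theta _) theta_jterm.
  rewrite -/(e m); ring.
rewrite big_ord_recl mul0r mul0r add0r [X in _ - X]big_ord_recr/= subnn mul0r mul0r addr0.
rewrite -sumrB scaler_sumr mulr_sumr; apply: eq_bigr => m _.
have mn : (m <= n)%N by rewrite -ltnS.
rewrite /bump leq0n add1n subSS subSn// -mul_polyC.
have -> : (m.+1%:R * e m.+1) = (n.+1%:R + a - m%:R) * (gbinom (n.+1%:R + a) m * gbinom (n.+1%:R + b) (n - m)).
  by rewrite /e subSS mulrA gbinomS !mulrA.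
have -> : ((n - m).+1%:R * e m) = (n.+1%:R + b - (n - m)%:R) * (gbinom (n.+1%:R + a) m * gbinom (n.+1%:R + b) (n - m)).
  by rewrite /e subSn// mulrCA gbinomS mulrCA.
have -> : n%:R + (a + 1) = n.+1%:R + a by rewrite -natr1; ring.
have -> : n%:R + (b + 1) = n.+1%:R + b by rewrite -natr1; ring.
rewrite natrB// /jterm !exprS -natr1.
move: (gbinom _ _) (gbinom _ _) => u v.
ring.
Qed.

(** One step of the Rodrigues formula. The binomial recurrences put the weights n+1-m and m on the
    m-th term of the sum of degree n+1, and these add up to n+1. *)
Lemma rho_deriv_shifted_jacobi n a b : rho_deriv a b (shifted_jacobi n (a + 1) (b + 1)) =
  - n.+1%:R *: shifted_jacobi n.+1 a b.
Proof.
pose c m := gbinom (n.+1%:R + a) m * gbinom (n.+1%:R + b) (n - m).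
pose e m := gbinom (n.+1%:R + a) m * gbinom (n.+1%:R + b) (n.+1 - m).
have -> : shifted_jacobi n (a + 1) (b + 1) = \sum_(m < n.+1) (c m)%:P * jterm (n - m) m.
  apply: eq_bigr => m _; rewrite /c -/(jterm _ _).
  have -> : n%:R + (a + 1) = n.+1%:R + a by rewrite -natr1; ring.
  have -> : n%:R + (b + 1) = n.+1%:R + b by rewrite -natr1; ring.
  by [].
have -> : shifted_jacobi n.+1 a b = \sum_(m < n.+2) (e m)%:P * jterm (n.+1 - m) m by [].
transitivity (- (\sum_(m < n.+1) ((n.+1 - m)%:R * e m)%:P * jterm (n.+1 - m) m +
    \sum_(m < n.+1) (m.+1%:R * e m.+1)%:P * jterm (n - m) m.+1)).
  rewrite -big_split -sumrN/= /rho_deriv mulr_sumr /theta deriv_sum mulr_sumr -big_split/=.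
  apply: eq_bigr => m _; rewrite deriv_mulC [X in _ + X]mulrCA -/(theta _) theta_jterm.
  have mn : (m <= n)%N by rewrite -ltnS.
  have -> : (m.+1%:R * e m.+1) = (n.+1%:R + a - m%:R) * c m.
    by rewrite /e subSS mulrA gbinomS !mulrA.
  have -> : ((n.+1 - m)%:R * e m) = (n.+1%:R + b - (n - m)%:R) * c m.
    by rewrite /e subSn// mulrCA gbinomS mulrCA.
  rewrite subSn// /jterm !exprS natrB// -natr1.
  rewrite -!mul_polyC; ring.
rewrite scaler_sumr.
have -> : \sum_(m < n.+1) ((n.+1 - m)%:R * e m)%:P * jterm (n.+1 - m) m =
    \sum_(m < n.+2) ((n.+1 - m)%:R * e m)%:P * jterm (n.+1 - m) m.
  by rewrite [RHS]big_ord_recr/= subnn !mul0r addr0.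
have -> : \sum_(m < n.+1) (m.+1%:R * e m.+1)%:P * jterm (n - m) m.+1 =
    \sum_(m < n.+2) (m%:R * e m)%:P * jterm (n.+1 - m) m.
  rewrite [RHS]big_ord_recl !mul0r add0r; apply: eq_bigr => m _ /=.
  by rewrite /bump leq0n add1n subSS.
rewrite -big_split -sumrN; apply: eq_bigr => m _ /=.
have mn : (m <= n.+1)%N by rewrite -ltnS.
rewrite natrB// -mul_polyC; ring.
Qed.

Lemma shifted_jacobi_reflect n a b x :
  (shifted_jacobi n a b).[1 - x] = (-1) ^+ n * (shifted_jacobi n b a).[x].
Proof.
rewrite /shifted_jacobi !horner_sum mulr_sumr (reindex_inj rev_ord_inj)/=.
apply: eq_bigr => m _; have mn : (m <= n)%N by rewrite -ltnS.
rewrite !hornerM !hornerC !horner_exp !hornerD !hornerN !hornerX !hornerC.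
rewrite subSS subKn// -[in (-1) ^+ n](subnK mn) exprD.
have -> : 1 - x - 1 = - x by ring.
have -> : 1 - x = - (x - 1) by ring.
rewrite (exprNn x) (exprNn (x - 1)); ring.
Qed.

End JacobiPolynomials.

(** * Orthogonality of Jacobi polynomials and of their derivatives *)

Section Orthogonality.
Variable R : realType.
Implicit Types (a b x y z c : R) (P Q : {poly R}).
Local Notation mu := (@lebesgue_measure R).
Local Notation I01 := (`]0%R, 1%R[%classic : set (measurableTypeR R)).

Definition dot a b P Q : R := int01 (fun x => rho a b x * (P * Q).[x]).

Let gtN1_add1 a : -1 < a -> -1 < a + 1.
Proof. by move=> a1; apply: (lt_trans a1); rewrite ltrDl. Qed.

Let natS_neq0 (n : nat) : n.+1%:R != 0 :> R.
Proof. by rewrite pnatr_eq0. Qed.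

Lemma dotC a b P Q : dot a b P Q = dot a b Q P.
Proof. by rewrite /dot mulrC. Qed.

Lemma dotZl a b c P Q : -1 < a -> -1 < b -> dot a b (c *: P) Q = c * dot a b P Q.
Proof.
move=> a1 b1; rewrite /dot -int01Z; last exact: itg_rho_poly.
by apply: int01_eq => x _; rewrite -(scalerAl c P Q) hornerZ; ring.
Qed.

Lemma dotDl a b P Q L : -1 < a -> -1 < b -> dot a b (P + Q) L = dot a b P L + dot a b Q L.
Proof.
move=> a1 b1; rewrite /dot -int01D; [|exact: itg_rho_poly..].
by apply: int01_eq => x _; rewrite mulrDl hornerD; ring.
Qed.

Lemma dot0l a b Q : dot a b 0 Q = 0.
Proof.
rewrite /dot -[RHS](@int01_cst0 R); apply: int01_eq => x _.
by rewrite mul0r horner0 mulr0.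
Qed.

Lemma dot_suml a b n (F : nat -> {poly R}) Q : -1 < a -> -1 < b ->
  dot a b (\sum_(i < n) F i) Q = \sum_(i < n) dot a b (F i) Q.
Proof.
move=> a1 b1; elim: n => [|n IH]; first by rewrite !big_ord0 dot0l.
by rewrite !big_ord_recr/= dotDl// IH.
Qed.

Lemma dot_ge0 a b P : 0 <= dot a b P P.
Proof.
apply: int01_ge0 => x _; rewrite mulr_ge0 ?rho_ge0// hornerM -expr2.
exact: sqr_ge0.
Qed.

Lemma dot_rho_deriv a b P Q : -1 < a -> -1 < b ->
  dot a b (rho_deriv a b P) Q = - dot (a + 1) (b + 1) P (Q^`()%R).
Proof.
move=> a1 b1; apply/eqP; rewrite -subr_eq0 opprK; apply/eqP.
rewrite -[RHS](int01_rho_deriv (P * Q) a1 b1) -int01D; last 2 first.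
- exact: itg_rho_poly.
- by apply: itg_rho_poly; exact: gtN1_add1.
apply: int01_eq => x x01; rewrite rhoD// rho11// /rho_deriv /theta derivM.
by rewrite !(hornerM, hornerD, hornerN, hornerX, hornerC, hornerZ); ring.
Qed.

Lemma dot_shifted_jacobiS n a b Q : -1 < a -> -1 < b ->
  n.+1%:R * dot a b (shifted_jacobi n.+1 a b) Q =
  dot (a + 1) (b + 1) (shifted_jacobi n (a + 1) (b + 1)) (Q^`()%R).
Proof.
move=> a1 b1; apply: oppr_inj; rewrite -dot_rho_deriv//.
by rewrite rho_deriv_shifted_jacobi dotZl// mulNr.
Qed.

(** Each integration by parts lowers both degrees and raises both exponents by one, until the
    smaller degree is 0 and the derivative kills the constant. *)
Lemma dot_shifted_jacobi_neq n m a b : -1 < a -> -1 < b -> n != m ->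
  dot a b (shifted_jacobi n a b) (shifted_jacobi m a b) = 0.
Proof.
have zero k c d : -1 < c -> -1 < d -> dot c d (shifted_jacobi k.+1 c d) (shifted_jacobi 0 c d) = 0.
  move=> c1 d1; apply: (mulfI (natS_neq0 k)).
  by rewrite dot_shifted_jacobiS// mulr0 shifted_jacobi0 -polyC1 derivC dotC dot0l.
elim: n m a b => [|n IH] [|m] a b a1 b1 //.
- by move=> _; rewrite dotC zero.
- by move=> _; rewrite zero.
rewrite eqSS => nm; apply: (mulfI (natS_neq0 n)).
rewrite dot_shifted_jacobiS// mulr0 shifted_jacobi_deriv dotC dotZl ?gtN1_add1//.
by rewrite dotC IH ?mulr0 ?gtN1_add1.
Qed.

Definition jacobi_sqnorm n a b : R := dot a b (shifted_jacobi n a b) (shifted_jacobi n a b).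

Lemma jacobi_sqnormS n a b : -1 < a -> -1 < b ->
  n.+1%:R * jacobi_sqnorm n.+1 a b = (n%:R + a + b + 2) * jacobi_sqnorm n (a + 1) (b + 1).
Proof.
move=> a1 b1; rewrite /jacobi_sqnorm dot_shifted_jacobiS// shifted_jacobi_deriv.
by rewrite dotC dotZl ?gtN1_add1// dotC.
Qed.

(* Eigenvalue of (-1)^l (rho a b)^-1 D^l (rho (a+l) (b+l) D^l _) on the n-th
   polynomial; it depends on s = a + b only and vanishes for n < l. *)
Definition jacobi_eigen (l n : nat) (s : R) : R :=
  \prod_(k < l) ((n%:R - k%:R) * (n%:R + s + 1 + k%:R)).

Lemma jacobi_eigenS l n s : jacobi_eigen l.+1 n.+1 s =
  n.+1%:R * (n%:R + s + 2) * jacobi_eigen l n (s + 2).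
Proof.
rewrite /jacobi_eigen big_ord_recl/= subr0 addr0 -natr1; congr (_ * _); first by ring.
by apply: eq_bigr => k _; rewrite /bump leq0n add1n -natr1; ring.
Qed.

Lemma jacobi_eigenS0 l s : jacobi_eigen l.+1 0 s = 0.
Proof. by rewrite /jacobi_eigen big_ord_recl/= subr0 !mul0r. Qed.

(** Differentiating both polynomials yields (n+a+b+2)^2. By [jacobi_sqnormS] one of the two factors
    turns the norm at raised exponents into n + 1 times the norm at (a, b), which completes the
    eigenvalue. *)
Lemma dot_derivn_shifted_jacobi l n m a b : -1 < a -> -1 < b ->
  dot (a + l%:R) (b + l%:R) ((shifted_jacobi n a b)^`(l)) ((shifted_jacobi m a b)^`(l)) =
  (n == m)%:R * jacobi_eigen l n (a + b) * jacobi_sqnorm n a b.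
Proof.
elim: l n m a b => [|l IH] n m a b a1 b1.
  rewrite !addr0 !derivn0 /jacobi_eigen big_ord0 mulr1.
  by have [->|nm] := eqVneq n m; rewrite ?mul1r// mul0r dot_shifted_jacobi_neq.
have d0 : (shifted_jacobi 0 a b)^`(l.+1) = 0.
  by rewrite shifted_jacobi0 -polyC1 derivSn derivC; elim: l {IH} => [|l IH]; rewrite ?derivn0// derivnS IH deriv0.
case: n => [|n]; first by rewrite d0 dot0l jacobi_eigenS0 mulr0 mul0r.
case: m => [|m]; first by rewrite d0 dotC dot0l !mul0r.
rewrite !derivSn !shifted_jacobi_deriv !derivnZ.
have -> : a + l.+1%:R = a + 1 + l%:R by rewrite -natr1; ring.
have -> : b + l.+1%:R = b + 1 + l%:R by rewrite -natr1; ring.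
have al : -1 < a + 1 + l%:R by rewrite (lt_le_trans (gtN1_add1 a1))// lerDl.
have bl : -1 < b + 1 + l%:R by rewrite (lt_le_trans (gtN1_add1 b1))// lerDl.
rewrite dotZl// dotC dotZl// dotC IH ?gtN1_add1// eqSS.
have [<-|_] := eqVneq n m; last by rewrite !mul0r !mulr0.
rewrite !mul1r jacobi_eigenS.
have -> : a + 1 + (b + 1) = a + b + 2 by ring.
transitivity ((n%:R + a + b + 2) * jacobi_eigen l n (a + b + 2) *
    ((n%:R + a + b + 2) * jacobi_sqnorm n (a + 1) (b + 1))); first by ring.
by rewrite -jacobi_sqnormS//; ring.
Qed.

Lemma rho_derivZ a b c P : rho_deriv a b (c *: P) = c *: rho_deriv a b P.
Proof. by rewrite /rho_deriv /theta derivZ -!scalerAr -scalerDr. Qed.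

Lemma rho_derivnZ j a b c P : rho_derivn j a b (c *: P) = c *: rho_derivn j a b P.
Proof. by elim: j a b => [//|j IH] a b /=; rewrite IH rho_derivZ. Qed.

Lemma rho_derivn_shifted_jacobi j n a b :
  rho_derivn j a b ((shifted_jacobi n a b)^`(j)) =
  ((-1) ^+ j * jacobi_eigen j n (a + b)) *: shifted_jacobi n a b.
Proof.
elim: j n a b => [|j IH] n a b.
  by rewrite /= /jacobi_eigen big_ord0 mulr1 scale1r.
case: n => [|n].
  rewrite shifted_jacobi0 -polyC1 derivSn derivC jacobi_eigenS0 mulr0 scale0r.
  have -> : (0 : {poly R})^`(j) = 0.
    by elim: j {IH} => [|j IH]; rewrite ?derivn0// derivnS IH deriv0.
  by have := rho_derivnZ j.+1 a b 0 0; rewrite !scale0r.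
rewrite derivSn shifted_jacobi_deriv derivnZ rho_derivnZ /= IH rho_derivZ.
rewrite rho_deriv_shifted_jacobi !scalerA jacobi_eigenS.
have -> : a + 1 + (b + 1) = a + b + 2 by ring.
by congr (_ *: _); rewrite exprS; ring.
Qed.

Lemma rho_reflect a b x : rho a b (1 - x) = rho b a x.
Proof. by rewrite /rho subKr mulrC. Qed.

(** Needed since f is expanded at exponents (beta - 1, alpha - beta - 1) and q at (alpha - beta,
    beta): raising the former pair by one gives the latter in swapped order. *)
Lemma jacobi_sqnorm_reflect n a b : jacobi_sqnorm n a b = jacobi_sqnorm n b a.
Proof.
rewrite /jacobi_sqnorm /dot -(@int01_reflect R (fun x => rho a b x * _)).
- apply: int01_eq => x _; rewrite rho_reflect !hornerM !shifted_jacobi_reflect.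
  have s1 : (-1) ^+ n * (-1) ^+ n = 1 :> R by rewrite -expr2 sqrr_sign.
  by congr (_ * _); rewrite mulrACA s1 mul1r.
- apply: measurable_funM; [exact: measurable_rho|exact: measurable_horner].
- by move=> x _; rewrite mulr_ge0 ?rho_ge0// hornerM -expr2 sqr_ge0.
Qed.

Lemma Gnorm_sqr n a b : Gnorm n a b ^+ 2 = jacobi_sqnorm n a b.
Proof.
have -> : jacobi_sqnorm n a b = int01 (fun x => rho a b x * Gpoly n a b x ^+ 2).
  by apply: int01_eq => x _; rewrite hornerM GpolyE expr2.
rewrite sqr_sqrtr//; apply: int01_ge0 => x _.
by rewrite mulr_ge0 ?rho_ge0// sqr_ge0.
Qed.

End Orthogonality.

(** * Weighted L2 spaces with real-valued squared norms *)

Section WeightedL2.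
Variable R : realType.
Implicit Types (a b x y z c : R) (P Q : {poly R}) (f g h u v phi : R -> R).
Local Notation mu := (@lebesgue_measure R).
Local Notation I01 := (`]0%R, 1%R[%classic : set (measurableTypeR R)).

Definition L2w a b v :=
  measurable_fun I01 v /\ itg (fun x => rho a b x * v x ^+ 2).
Definition sqnorm a b v : R := int01 (fun x => rho a b x * v x ^+ 2).

Lemma sqnorm_ge0 a b v : 0 <= sqnorm a b v.
Proof. by apply: int01_ge0 => x _; rewrite mulr_ge0 ?rho_ge0 ?sqr_ge0. Qed.

Lemma sqnorm_eq a b u v : (forall x, 0 < x < 1 -> u x = v x) -> sqnorm a b u = sqnorm a b v.
Proof. by move=> uv; apply: int01_eq => x /uv ->. Qed.

Lemma L2w_eq a b u v : (forall x, 0 < x < 1 -> u x = v x) -> L2w a b u -> L2w a b v.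
Proof.
move=> uv [mu_ iu]; split; last by apply: itg_eq iu => x /uv ->.
by apply: eq_measurable_fun mu_ => x /set_mem /in01 /uv.
Qed.

Lemma L2w_mul a b u v : L2w a b u -> L2w a b v -> itg (fun x => rho a b x * (u x * v x)).
Proof.
move=> [mu_ iu] [mv iv]; apply: le_itg (itgD iu iv).
  by apply: measurable_funM; [exact: measurable_rho|exact: measurable_funM].
move=> x _; rewrite normrM ger0_norm ?rho_ge0// -mulrDr ler_wpM2l ?rho_ge0//.
rewrite ler_norml; move: (u x) (v x) => s t; apply/andP; split; nra.
Qed.

Lemma L2wD a b u v : L2w a b u -> L2w a b v -> L2w a b (fun x => u x + v x).
Proof.
move=> hu hv; have [[mu_ iu] [mv iv]] := (hu, hv).
split; first exact: measurable_funD.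
have := itgD (itgD iu iv) (itgZ 2 (L2w_mul hu hv)).
by apply: itg_eq => x _; ring.
Qed.

Lemma L2wZ a b c u : L2w a b u -> L2w a b (fun x => c * u x).
Proof.
move=> [mu_ iu]; split; first exact: measurable_funM.
by have := itgZ (c ^+ 2) iu; apply: itg_eq => x _; ring.
Qed.

Lemma L2wB a b u v : L2w a b u -> L2w a b v -> L2w a b (fun x => u x - v x).
Proof.
by move=> hu hv; apply: L2w_eq (L2wD hu (L2wZ (-1) hv)) => x _; rewrite mulN1r.
Qed.

Lemma L2w_poly a b P : -1 < a -> -1 < b -> L2w a b (horner P).
Proof.
move=> a1 b1; split; first exact: measurable_horner.
have := itg_rho_poly (P ^+ 2) a1 b1.
by apply: itg_eq => x _; rewrite horner_exp.
Qed.

Lemma L2w_itg a b v : -1 < a -> -1 < b -> L2w a b v -> itg (fun x => rho a b x * v x).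
Proof.
move=> a1 b1 hv; have := L2w_mul hv (L2w_poly 1 a1 b1).
by apply: itg_eq => x _; rewrite hornerC mulr1.
Qed.

Lemma cauchy_schwarz01 a b u v : L2w a b u -> L2w a b v ->
  int01 (fun x => rho a b x * (u x * v x)) ^+ 2 <= sqnorm a b u * sqnorm a b v.
Proof.
move=> hu hv.
set B := int01 _; set A := sqnorm a b u; set D := sqnorm a b v.
have H t : 0 <= A + 2 * t * B + t ^+ 2 * D.
  have := sqnorm_ge0 a b (fun x => u x + t * v x).
  suff -> : sqnorm a b (fun x => u x + t * v x) = A + 2 * t * B + t ^+ 2 * D by [].
  have [_ iu] := hu; have [_ iv] := hv; have iuv := L2w_mul hu hv.
  rewrite /A /B /D /sqnorm -(int01Z (2 * t) iuv) -(int01Z (t ^+ 2) iv).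
  rewrite -int01D//; last exact: itgZ.
  rewrite -int01D//; last 2 first.
    by apply: itgD => //; exact: itgZ.
    exact: itgZ.
  by apply: int01_eq => x _; ring.
have A0 : 0 <= A := sqnorm_ge0 _ _ _.
have D0 : 0 <= D := sqnorm_ge0 _ _ _.
have [D0'|Dpos] := eqVneq D 0.
  have [->|B0] := eqVneq B 0; first by rewrite expr0n/= mulr_ge0.
  (* When D = 0 the quadratic in t is affine, and at this t its value is -1. *)
  have := H (- (A + 1) / (2 * B)); rewrite D0' mulr0 addr0.
  have -> : 2 * (- (A + 1) / (2 * B)) * B = - (A + 1) by field.
  lra.
have Dp : 0 < D by rewrite lt_neqAle eq_sym Dpos.
have := H (- B / D).
have -> : A + 2 * (- B / D) * B + (- B / D) ^+ 2 * D = A - B ^+ 2 / D by field.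
by rewrite subr_ge0 ler_pdivrMr.
Qed.

Lemma inL2_L2w a b v : inL2 (rho a b) v -> L2w a b v.
Proof.
move=> [mv]; rewrite /L2norm => fin; split => //; apply/integrableP; split.
  apply/measurable_EFinP; apply: measurable_funM; first exact: measurable_rho.
  exact: measurable_funX.
rewrite (@eq_integral _ _ _ mu I01 (fun x => (rho a b x * v x ^+ 2)%:E)); last first.
  by move=> x _; rewrite gee0_abs// lee_fin mulr_ge0 ?rho_ge0 ?sqr_ge0.
move: fin; case: integral => //=.
by move=> r _; exact: ltry.
Qed.

Lemma L2normE a b v : L2w a b v -> L2norm (rho a b) v = (Num.sqrt (sqnorm a b v))%:E.
Proof.
move=> [_ iv]; rewrite /L2norm /sqnorm /int01 /Rintegral.
have := integrable_fin_num (@measurable_I01 R) iv.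
by rewrite /comp; case: integral.
Qed.

End WeightedL2.

(** * Completeness of the weighted L2 spaces *)

Section RieszFischer.
Variable R : realType.
Implicit Types (a b x y z c : R) (P Q : {poly R}) (f g h u v phi : R -> R).
Local Notation mu := (@lebesgue_measure R).
Local Notation I01 := (`]0%R, 1%R[%classic : set (measurableTypeR R)).

Lemma EFin_int01 f : itg f -> (int01 f)%:E = (\int[mu]_(x in I01) (f x)%:E)%E.
Proof. by move=> itf; rewrite /int01 /Rintegral fineK//; exact: integrable_fin_num itf. Qed.

(** By monotone convergence the sum of the series is integrable, hence finite almost everywhere, and
    it bounds its own partial sums. *)
Lemma bounded_int01_series_ae (d : nat -> R -> R) M :
  (forall k, itg (d k)) -> (forall k x, 0 < x < 1 -> 0 <= d k x) ->
  (forall n, \sum_(k < n) int01 (d k) <= M) ->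
  {ae mu, forall x, I01 x -> exists B, forall n, \sum_(k < n) d k x <= B}.
Proof.
move=> itd d0 dM.
have md k : measurable_fun I01 (fun x => (d k x)%:E).
  by apply/measurable_EFinP; exact: itg_measurable.
have d0' k x : I01 x -> (0 <= (d k x)%:E)%E by move=> /in01 /(d0 k); rewrite lee_fin.
pose H x := (\sum_(k <oo) (d k x)%:E)%E.
have mH : measurable_fun I01 H by apply: ge0_emeasurable_sum => // k x /d0'.
have itH : mu.-integrable I01 H.
  apply/integrableP; split => //.
  rewrite (@eq_integral _ _ _ mu I01 H); last first.
    by move=> x /set_mem xI; rewrite gee0_abs//; apply: nneseries_ge0 => k _ _; exact: d0'.
  rewrite integral_nneseries//; apply: (@le_lt_trans _ _ M%:E); last exact: ltry.
  apply: lime_le.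
    by apply: is_cvg_nneseries => k _ _; apply: integral_ge0 => x /d0'.
  apply: nearW => n; rewrite big_mkord.
  under eq_bigr do rewrite -EFin_int01//.
  by rewrite sumEFin lee_fin.
have := integrable_ae (@measurable_I01 R) itH.
apply: filterS => x /= h xI; have Hfin := h xI.
exists (fine (H x)) => n.
rewrite -lee_fin fineK// -sumEFin -(big_mkord xpredT (fun k => (d k x)%:E)).
by apply: nneseries_lim_ge => k _ _; exact: d0'.
Qed.

Lemma cvg_of_bounded_variation (u : nat -> R) B :
  (forall n, \sum_(k < n) `|u k.+1 - u k| <= B) -> cvgn u.
Proof.
move=> hB.
have h : cvgn [normed series (telescope u)].
  apply: nondecreasing_is_cvgn.
    apply/nondecreasing_seqP => n /=.
    by rewrite /normed_series_of/= !seriesEnat/= big_nat_recr//= lerDl.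
  by exists B => _ [n _ <-]; rewrite /= seriesEnat/= big_mkord; exact: hB.
have /= := normed_cvg h; rewrite telescopeK => c.
suff <- : (fun n => (u n - u 0%N) + u 0%N) = u.
  exact: (is_cvgD c (is_cvg_cst (u 0%N))).
by apply/funext => n; rewrite subrK.
Qed.

Lemma EFin_sqnorm a b v : L2w a b v ->
  (sqnorm a b v)%:E = (\int[mu]_(x in I01) (rho a b x * v x ^+ 2)%:E)%E.
Proof. by move=> [_ /EFin_int01]. Qed.

(** Integrate |v| <= e + v^2 / e against the weight, whose total mass is finite. *)
Lemma le_int01_abs a b v e : -1 < a -> -1 < b -> L2w a b v -> 0 < e ->
  sqnorm a b v <= e ^+ 2 ->
  int01 (fun x => rho a b x * `|v x|) <= e * (int01 (rho a b) + 1).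
Proof.
move=> a1 b1 hv e0 he; have [mv iv] := hv.
have ir := itg_rho a1 b1.
have iav : itg (fun x => rho a b x * `|v x|).
  have := itg_norm (L2w_itg a1 b1 hv); apply: itg_eq => x _.
  by rewrite normrM ger0_norm ?rho_ge0.
have i1 := itgZ e ir; have i2 := itgZ e^-1 iv.
apply: (@le_trans _ _ (int01 (fun x => e * rho a b x + e^-1 * (rho a b x * v x ^+ 2)))).
  apply: le_int01 => //; first exact: itgD.
  move=> x _; rewrite (_ : _ + _ = rho a b x * (e + e^-1 * v x ^+ 2)); last by ring.
  rewrite ler_wpM2l ?rho_ge0// -(ler_pM2l e0) mulrDr mulVKf ?gt_eqF//.
  rewrite -[v x ^+ 2]real_normK ?num_real//.
  by move: (`|v x|) (normr_ge0 (v x)) => t t0; nra.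
rewrite int01D// int01Z// int01Z// mulrDr lerD2l mulr1.
rewrite -(ler_pM2l e0) mulVKf ?gt_eqF//.
Qed.

Lemma riesz_fischer a b (s : nat -> R -> R) : -1 < a -> -1 < b ->
  (forall n, L2w a b (s n)) ->
  (forall e, 0 < e -> exists N, forall n m, (N <= n)%N -> (N <= m)%N ->
    sqnorm a b (fun x => s n x - s m x) <= e) ->
  exists2 g, L2w a b g & sqnorm a b (fun x => g x - s n x) @[n --> \oo] --> (0 : R).
Proof.
move=> a1 b1 sL2 cauchy_s.
have /choice[Nf hN] : forall k : nat, exists N, forall n m, (N <= n)%N -> (N <= m)%N ->
    sqnorm a b (fun x => s n x - s m x) <= (2 ^- k) ^+ 2.
  by move=> k; apply: cauchy_s; rewrite exprn_gt0// invr_gt0 exprn_gt0.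
(* The sum exceeds every [Nf i] with i <= k, so consecutive terms of the subsequence differ by at
   most 2^-k in norm. *)
pose n_ k := (\sum_(i < k.+1) Nf i)%N.
have n_ge k j : (k <= j)%N -> (Nf k <= n_ j)%N.
  by move=> kj; rewrite /n_ (bigD1 (Ordinal (kj : (k < j.+1)%N)))//= leq_addr.
pose t k := s (n_ k).
pose d k x := rho a b x * `|t k.+1 x - t k x|.
have L2d k : L2w a b (fun x => t k.+1 x - t k x) by exact: (L2wB (sL2 _) (sL2 _)).
have itd k : itg (d k).
  have := itg_norm (L2w_itg a1 b1 (L2d k)); apply: itg_eq => x _.
  by rewrite normrM ger0_norm ?rho_ge0.
have d0 k x : 0 < x < 1 -> 0 <= d k x by rewrite mulr_ge0 ?rho_ge0.
set W := int01 (rho a b) + 1.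
have W0 : 0 <= W by rewrite addr_ge0// int01_ge0// => x _; exact: rho_ge0.
have dM n : \sum_(k < n) int01 (d k) <= 2 * W.
  apply: (@le_trans _ _ (\sum_(k < n) 2 ^- k * W)).
    apply: ler_sum => k _; apply: le_int01_abs => //.
    by apply: hN; apply: n_ge.
  rewrite -mulr_suml ler_wpM2r//.
  have : \sum_(k < n) (2 ^- k : R) = 2 - 2 * 2 ^- n.
    elim: n => [|n IH]; first by rewrite big_ord0 expr0 invr1; ring.
    by rewrite big_ord_recr/= IH exprS invfM; field; rewrite expf_neq0.
  by move=> ->; rewrite gerBl mulr_ge0 ?invr_ge0 ?exprn_ge0.
have aecvg : {ae mu, forall x, I01 x -> cvgn (t ^~ x)}.
  have := bounded_int01_series_ae itd d0 dM.
  apply: (@filterS _ _ (ae_filter_ringOfSetsType mu)) => x /= h xI; have [B hB] := h xI.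
  have r0 : 0 < rho a b x by apply: rho_gt0; exact: (in01 xI).
  apply: (@cvg_of_bounded_variation _ (B / rho a b x)) => n.
  rewrite ler_pdivlMr// mulr_suml (le_trans _ (hB n))//.
  by apply: ler_sum => k _; rewrite /d mulrC.
(* The upper limit is measurable everywhere and equals the limit wherever the subsequence converges,
   so no exceptional set has to be removed. *)
pose g x := fine (limn_esup (fun k => (t k x)%:E)).
have mt k : measurable_fun I01 (t k) by have [] := sL2 (n_ k).
have mg : measurable_fun I01 g.
  apply: measurableT_comp => /=; first exact: fine_measurable.
  by apply: measurable_fun_limn_esup => k; exact/measurable_EFinP.
have cvg_g x : cvgn (t ^~ x) -> t k x @[k --> \oo] --> g x.
  move=> /cvg_ex[l tl]; rewrite /g.
  have : (t k x)%:E @[k --> \oo] --> l%:E by apply: cvg_EFin => //; exact: nearW.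
  by move=> h; rewrite is_cvg_limn_esupE; [rewrite (cvg_lim _ h)|apply/cvg_ex; exists l%:E].
(* Fatou's lemma along the subsequence: the Cauchy bound between [t k] and [s n], valid for large k,
   passes to [g]. *)
have key j n : (Nf j <= n)%N ->
    (\int[mu]_(x in I01) (rho a b x * (g x - s n x) ^+ 2)%:E <= ((2 ^- j) ^+ 2)%:E)%E.
  move=> jn.
  pose F k x := (rho a b x * (t k x - s n x) ^+ 2)%:E.
  have mF k : measurable_fun I01 (F k).
    apply/measurable_EFinP; apply: measurable_funM; first exact: measurable_rho.
    by apply: measurable_funX; apply: measurable_funB => //; have [] := sL2 n.
  have F0 k x : I01 x -> (0 <= F k x)%E by rewrite lee_fin mulr_ge0 ?rho_ge0 ?sqr_ge0.
  have FL k : (\int[mu]_(x in I01) F k x)%E = (sqnorm a b (fun x => t k x - s n x))%:E.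
    by rewrite EFin_sqnorm//; exact: (L2wB (sL2 _) (sL2 _)).
  have := fatou mu (@measurable_I01 R) mF F0.
  have -> : (\int[mu]_(x in I01) limn_einf (F ^~ x) =
      \int[mu]_(x in I01) (rho a b x * (g x - s n x) ^+ 2)%:E)%E.
    apply: ae_eq_integral => //.
    - have -> : (fun x => limn_einf (F ^~ x)) = (fun x => - limn_esup (fun k => - F k x))%E by [].
      apply: measurableT_comp => //; apply: measurable_fun_limn_esup => k.
      exact: measurableT_comp.
    - apply/measurable_EFinP; apply: measurable_funM; first exact: measurable_rho.
      by apply: measurable_funX; apply: measurable_funB => //; have [] := sL2 n.
    - apply: (@filterS _ _ (ae_filter_ringOfSetsType mu) _ _ _ aecvg) => x /= h xI.
      have := cvg_g _ (h xI) => c.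
      have cF : F k x @[k --> \oo] --> (rho a b x * (g x - s n x) ^+ 2)%:E.
        apply: cvg_EFin; first exact: nearW.
        apply: cvgM; first exact: cvg_cst.
        by apply: cvgM; apply: cvgB => //; exact: cvg_cst.
      by rewrite is_cvg_limn_einfE; [rewrite (cvg_lim _ cF)|apply/cvg_ex; eexists; exact: cF].
  move=> /le_trans; apply; rewrite limn_einf_lim.
  apply: lime_le; first exact: is_cvg_einfs.
  near=> k.
  apply: (@le_trans _ _ (\int[mu]_(x in I01) F k x)%E).
    by apply: ereal_inf_lbound; exists k => //=.
  rewrite FL lee_fin; apply: hN => //; apply: n_ge.
  by near: k; exact: nbhs_infty_ge.
have gL2 : L2w a b g.
  have h : L2w a b (fun x => g x - s (Nf 0%N) x).
    split; first by apply: measurable_funB => //; have [] := sL2 (Nf 0%N).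
    apply/integrableP; split.
      apply/measurable_EFinP; apply: measurable_funM; first exact: measurable_rho.
      by apply: measurable_funX; apply: measurable_funB => //; have [] := sL2 (Nf 0%N).
    apply: le_lt_trans (ltry (((2 ^- 0) ^+ 2 : R))).
    apply: le_trans (key _ _ (leqnn _)); rewrite le_eqVlt; apply/orP; left; apply/eqP.
    by apply: eq_integral => x _; rewrite gee0_abs// lee_fin mulr_ge0 ?rho_ge0 ?sqr_ge0.
  by apply: L2w_eq (L2wD h (sL2 (Nf 0%N))) => x _; rewrite subrK.
exists g => //.
apply/cvgrPdist_le => e e0.
have [j hj] : exists j : nat, (2 ^- j) ^+ 2 <= e.
  exists (Num.truncn e^-1).+1.
  set m := (Num.truncn e^-1).+1.
  have hm : e^-1 < m%:R by rewrite truncnS_gt.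
  have m2 : m%:R <= (2 ^+ m) ^+ 2 :> R.
    rewrite -natrX -natrX ler_nat (leq_trans (ltnW (ltn_expl m (ltnSn 1))))//.
    by rewrite -[leqLHS]expn1 leq_pexp2l// expn_gt0.
  rewrite exprVn -[leRHS]invrK lef_pV2 ?posrE ?invr_gt0 ?exprn_gt0//.
  exact: (le_trans (ltW hm) m2).
near=> n.
rewrite sub0r normrN ger0_norm ?sqnorm_ge0// -lee_fin EFin_sqnorm; last exact: (L2wB gL2 (sL2 _)).
apply: (@le_trans _ _ ((2 ^- j) ^+ 2)%:E); last by rewrite lee_fin.
apply: key; near: n; exact: nbhs_infty_ge.
Unshelve. all: by end_near. Qed.

End RieszFischer.

(** * Test functions and closedness of weak derivatives *)

Section WeakDerivatives.
Variable R : realType.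
Implicit Types (a b x y z c : R) (P Q : {poly R}) (f g h u v phi psi : R -> R).
Local Notation mu := (@lebesgue_measure R).
Local Notation I01 := (`]0%R, 1%R[%classic : set (measurableTypeR R)).

Lemma derive1nSr (n : nat) phi : derive1n n.+1 phi = derive1n n (derive1 phi).
Proof. by rewrite /derive1n iterSr. Qed.

Lemma test_function_derive1 phi : test_function phi -> test_function (derive1 phi).
Proof.
move=> [dphi [K [cK KI phi0]]]; split=> [n x|]; first by rewrite -derive1nSr; exact: dphi.
exists K; split => // x xK; rewrite derive1E.
rewrite (@near_eq_derive _ _ _ _ (cst 0)) ?derive_cst//.
have oK : open (~` K) by apply: closed_openC; exact: compact_closed.
by apply: filterS (open_nbhs_nbhs (conj oK xK)) => z /phi0.
Qed.

Lemma test_function_derive1n n phi : test_function phi -> test_function (derive1n n phi).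
Proof. by move=> h; elim: n => [//|n IH]; rewrite derive1nS; exact: test_function_derive1. Qed.

Lemma test_function_derivable phi x : test_function phi -> derivable phi x 1.
Proof. by move=> [/(_ 0%N)]. Qed.

Lemma test_function_continuous phi : test_function phi -> continuous phi.
Proof. by move=> tphi; apply: derivable_continuous => x; exact: test_function_derivable. Qed.

Lemma test_function_out phi x : test_function phi -> ~~ (0 < x < 1) -> phi x = 0.
Proof.
move=> [_ [K [_ KI phi0]]] x01; apply: phi0 => /KI; rewrite /= in_itv/=.
exact/negP.
Qed.

Lemma continuous_rho a b x : 0 < x < 1 -> {for x, continuous (rho a b)}.
Proof.
move=> x01; have := is_derive_rho (a - 1) (b - 1) x01.
by rewrite !subrK => -[h _]; apply/differentiable_continuous/derivable1_diffP.
Qed.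

Lemma continuous_compact_bound (K : set R) f : compact K -> {within K, continuous f} ->
  exists2 C, 0 <= C & forall x, K x -> `|f x| <= C.
Proof.
move=> cK cf; have [M [_ hM]] := compact_bounded (continuous_compact cf cK).
exists (`|M| + 1) => [|x Kx]; first by rewrite addr_ge0.
have lt : M < `|M| + 1 by rewrite (le_lt_trans (ler_norm _))// ltrDl.
exact: (hM _ lt (f x) (ex_intro2 _ _ x Kx erefl)).
Qed.

(** The weight has a positive minimum on the compact support, whatever the signs of the exponents.
    Hence phi / rho is bounded, and pairings with phi become weighted inner products. *)
Lemma test_function_rho_bound a b phi : test_function phi ->
  exists2 C, 0 <= C & forall x, 0 < x < 1 -> `|phi x| <= C * rho a b x.
Proof.
move=> tphi; have [_ [K [cK KI phi0]]] := tphi.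
have cq : {within K, continuous (fun x => phi x / rho a b x)}.
  apply: continuous_in_subspaceT => x /set_mem /KI /in01 x01.
  apply: cvgM; first exact: test_function_continuous.
  by apply: cvgV; [rewrite gt_eqF// rho_gt0|exact: continuous_rho].
have [C C0 hC] := continuous_compact_bound cK cq.
exists C => // x x01; have r0 := rho_gt0 a b x01.
have [xK|xK] := pselect (K x); last by rewrite phi0// normr0 mulr_ge0// rho_ge0.
rewrite -ler_pdivrMr//; have := hC x xK.
by rewrite normrM normfV (ger0_norm (ltW r0)).
Qed.

Lemma L2w_test a b phi : -1 < a -> -1 < b -> test_function phi ->
  L2w a b (fun x => phi x / rho a b x).
Proof.
move=> a1 b1 tphi; have [C C0 hC] := test_function_rho_bound a b tphi.
have mphi : measurable_fun I01 (fun x => phi x / rho a b x).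
  apply: measurable_funM.
    by apply: continuous_measurable01; exact: test_function_continuous.
  rewrite (_ : (fun x => _) = (fun x => rho (- a) (- b) x)); first exact: measurable_rho.
  by apply/funext => x; rewrite /rho !powRN invfM.
split => //; apply: le_itg (itgZ (C ^+ 2) (itg_rho a1 b1)).
  by apply: measurable_funM; [exact: measurable_rho|exact: measurable_funX].
move=> x x01; have r0 := rho_gt0 a b x01.
rewrite ger0_norm; last by rewrite mulr_ge0 ?rho_ge0 ?sqr_ge0.
rewrite mulrC ler_wpM2r ?rho_ge0//.
rewrite -[_ ^+ 2]real_normK ?num_real// lerXn2r ?nnegrE//.
by rewrite normrM normfV (ger0_norm (ltW r0)) ler_pdivrMr// hC.
Qed.

Lemma L2w_test_pairing a b v phi : -1 < a -> -1 < b -> L2w a b v -> test_function phi ->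
  itg (fun x => v x * phi x) /\
  int01 (fun x => v x * phi x) ^+ 2 <=
    sqnorm a b v * sqnorm a b (fun x => phi x / rho a b x).
Proof.
move=> a1 b1 vL2 tphi; have pL2 := L2w_test a1 b1 tphi.
have E x : 0 < x < 1 -> rho a b x * (v x * (phi x / rho a b x)) = v x * phi x.
  by move=> x01; field; rewrite gt_eqF// rho_gt0.
split; first exact: itg_eq E (L2w_mul vL2 pL2).
by rewrite -(int01_eq E); exact: cauchy_schwarz01.
Qed.

(** On a compact set the weight is bounded below, so |v| <= 1 + v^2 <= 1 + C rho v^2. *)
Lemma L2w_locally_integrable a b v : L2w a b v -> locally_integrable I01 v.
Proof.
move=> [mv iv]; split => //.
move=> K KI cK.
have mK : measurable (K : set (measurableTypeR R)) by exact: compact_measurable.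
have cr : {within K, continuous (fun x => (rho a b x)^-1)}.
  apply: continuous_in_subspaceT => x /set_mem /KI /in01 x01.
  by apply: cvgV; [rewrite gt_eqF// rho_gt0|exact: continuous_rho].
have [C C0 hC] := continuous_compact_bound cK cr.
have i1 : mu.-integrable K (EFin \o cst 1).
  by apply: continuous_compact_integrable => //; apply: continuous_subspaceT => x; exact: cvg_cst.
have i2 : mu.-integrable K (EFin \o (fun x => C * (rho a b x * v x ^+ 2))).
  apply: (@integrableS _ _ _ mu I01) => //.
  exact: itgZ iv.
have i3 := integrableD mK i1 i2.
apply: (@le_lt_trans _ _ (\int[mu]_(x in K) (1 + C * (rho a b x * v x ^+ 2))%:E)%E); last first.
  have /integrableP[_] := i3; apply: le_lt_trans; apply: ge0_le_integral => //.
  - by move=> x _; rewrite lee_fin addr_ge0 ?ler01// mulr_ge0// mulr_ge0 ?rho_ge0 ?sqr_ge0.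
  - by have := measurable_int _ i3.
  - by apply: measurableT_comp => //; have := measurable_int _ i3.
  - by move=> x _; exact: lee_abs.
apply: ge0_le_integral => //.
- by apply/measurable_EFinP; apply: measurableT_comp => //; apply: measurable_funS mv.
- by have := measurable_int _ i3.
move=> x Kx; have x01 := in01 (KI _ Kx); have r0 := rho_gt0 a b x01.
rewrite lee_fin.
have h1 : 1 <= C * rho a b x.
  rewrite -ler_pdivrMr// mul1r; have := hC x Kx.
  by rewrite normfV (ger0_norm (ltW r0)).
rewrite mulrA -[v x ^+ 2]real_normK ?num_real//.
move: (`|v x|) (normr_ge0 (v x)) => t t0.
apply: (@le_trans _ _ (1 + t ^+ 2)); first by nra.
by rewrite lerD2l ler_peMl// sqr_ge0.
Qed.

Lemma test_function_ibp_poly P phi : test_function phi ->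
  int01 (fun x => P.[x] * derive1 phi x) = - int01 (fun x => P^`()%R.[x] * phi x).
Proof.
move=> tphi; have cphi := test_function_continuous tphi.
have cphi' := test_function_continuous (test_function_derive1 tphi).
have i1 : itg (fun x => P.[x] * derive1 phi x).
  by apply: itg_continuous => x; apply: cvgM; [exact: continuous_horner|exact: cphi'].
have i2 : itg (fun x => P^`()%R.[x] * phi x).
  by apply: itg_continuous => x; apply: cvgM; [exact: continuous_horner|exact: cphi].
have dP x : is_derive x 1 (fun z => P.[z] * phi z) (P^`()%R.[x] * phi x + P.[x] * derive1 phi x).
  apply: is_derive_mul; rewrite derive1E; apply: DeriveDef => //.
  exact: test_function_derivable.
apply/eqP; rewrite -subr_eq0 opprK -int01D//; apply/eqP.
have <- : derive1 (fun z => P.[z] * phi z) = (fun x => P.[x] * derive1 phi x + P^`()%R.[x] * phi x).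
  by apply/funext => x; rewrite derive1E; have [_ ->] := dP x; rewrite addrC.
apply: int01_derive_eq0.
- by move=> x; have [] := dP x.
- rewrite (_ : derive1 _ = (fun x => P^`()%R.[x] * phi x + P.[x] * derive1 phi x)).
    move=> x; apply: cvgD.
      by apply: cvgM; [exact: continuous_horner|exact: cphi].
    by apply: cvgM; [exact: continuous_horner|exact: cphi'].
  by apply/funext => x; rewrite derive1E; have [_ ->] := dP x.
- by rewrite (test_function_out tphi) ?mulr0// ltxx.
- by rewrite (test_function_out tphi) ?mulr0// ltxx andbF.
Qed.

Lemma test_function_ibpn_poly l P phi : test_function phi ->
  int01 (fun x => P.[x] * derive1n l phi x) = (-1) ^+ l * int01 (fun x => (P^`(l)).[x] * phi x).
Proof.
move=> tphi; elim: l P => [|l IH] P; first by rewrite expr0 mul1r derivn0.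
rewrite derive1nS test_function_ibp_poly; last exact: test_function_derive1n.
by rewrite IH derivSn exprS mulN1r mulNr.
Qed.

(** For the polynomials [p n] integration by parts is exact. The defect [D] of the pair (u, g) is
    therefore bounded by the two approximation errors through Cauchy-Schwarz; it does not depend on
    n, so it is 0. *)
Lemma weak_derivative_limit l a b u g (p : nat -> {poly R}) : -1 < a -> -1 < b ->
  L2w a b u -> L2w (a + l%:R) (b + l%:R) g ->
  sqnorm a b (fun x => u x - (p n).[x]) @[n --> \oo] --> (0 : R) ->
  sqnorm (a + l%:R) (b + l%:R) (fun x => g x - ((p n)^`(l)).[x]) @[n --> \oo] --> (0 : R) ->
  weak_derivative l u g.
Proof.
move=> a1 b1 uL2 gL2 pu pg.
have al : -1 < a + l%:R by rewrite (lt_le_trans a1)// lerDl.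
have bl : -1 < b + l%:R by rewrite (lt_le_trans b1)// lerDl.
split; [exact: L2w_locally_integrable uL2|exact: L2w_locally_integrable gL2|].
move=> phi tphi; have tphil := test_function_derive1n l tphi.
rewrite -[LHS]/(int01 (fun x => u x * derive1n l phi x)).
rewrite -[X in _ * X]/(int01 (fun x => g x * phi x)).
apply/eqP; rewrite -subr_eq0 -sqrf_eq0 eq_le sqr_ge0 andbT.
set D := _ - _.
set K1 := sqnorm a b (fun x => derive1n l phi x / rho a b x).
set K2 := sqnorm (a + l%:R) (b + l%:R) (fun x => phi x / rho (a + l%:R) (b + l%:R) x).
have DE n : D ^+ 2 <= 2 * (sqnorm a b (fun x => u x - (p n).[x]) * K1) +
    2 * (sqnorm (a + l%:R) (b + l%:R) (fun x => g x - ((p n)^`(l)).[x]) * K2).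
  have pL2 := L2w_poly (p n) a1 b1; have plL2 := L2w_poly ((p n)^`(l)) al bl.
  have [i1 _] := L2w_test_pairing a1 b1 uL2 tphil.
  have [i2 _] := L2w_test_pairing a1 b1 pL2 tphil.
  have [i3 _] := L2w_test_pairing al bl gL2 tphi.
  have [i4 _] := L2w_test_pairing al bl plL2 tphi.
  have [_] := L2w_test_pairing a1 b1 (L2wB uL2 pL2) tphil.
  have [_] := L2w_test_pairing al bl (L2wB gL2 plL2) tphi.
  rewrite (_ : int01 _ = int01 (fun x => g x * phi x) - int01 (fun x => ((p n)^`(l)).[x] * phi x)); last first.
    by rewrite -int01B//; apply: int01_eq => x _; rewrite mulrBl.
  rewrite (_ : int01 (fun x => (u x - _) * _) = int01 (fun x => u x * derive1n l phi x) -
      int01 (fun x => (p n).[x] * derive1n l phi x)); last first.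
    by rewrite -int01B//; apply: int01_eq => x _; rewrite mulrBl.
  rewrite (test_function_ibpn_poly l (p n) tphi) /D -/K1 -/K2.
  have s2 : ((-1) ^+ l) ^+ 2 = 1 :> R by rewrite sqrr_sign.
  set X := int01 (fun x => u x * _); set Y := int01 (fun x => g x * _).
  set Z := int01 (fun x => _ * phi x).
  move: (sqnorm _ _ _ * K1) (sqnorm _ _ _ * K2) => A B h1 h2.
  (* With the sign e = (-1)^l one has D = (X - e Z) - e (Y - Z); the square of a difference is at
     most twice the sum of the squares. *)
  have : 2 * (X - (-1) ^+ l * Z) ^+ 2 + 2 * (Y - Z) ^+ 2 <= 2 * A + 2 * B by lra.
  apply: le_trans; move: ((-1) ^+ l) s2 => e s2; rewrite -subr_ge0.
  rewrite (_ : _ - _ = (X - e * Z + e * (Y - Z)) ^+ 2 + 2 * (1 - e ^+ 2) * (Y - Z) ^+ 2); last ring.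
  by rewrite s2 subrr mulr0 mul0r addr0 sqr_ge0.
have lim0 : 2 * (sqnorm a b (fun x => u x - (p n).[x]) * K1) +
    2 * (sqnorm (a + l%:R) (b + l%:R) (fun x => g x - ((p n)^`(l)).[x]) * K2) @[n --> \oo] --> (0 : R).
  have -> : (0 : R) = 2 * (0 * K1) + 2 * (0 * K2) by ring.
  by apply: cvgD; (apply: cvgM; first exact: cvg_cst); (apply: cvgM; last exact: cvg_cst).
rewrite -(cvg_lim (@norm_hausdorff _ R) lim0); apply: limr_ge.
  by apply/cvg_ex; eexists; exact: lim0.
exact: nearW.
Qed.

End WeakDerivatives.

(** * Uniqueness of weak derivatives almost everywhere *)

Section WeakDerivativeUniqueness.
Variable R : realType.
Implicit Types (a b c d s t x y z : R) (P Q : {poly R}) (f g h u v phi psi : R -> R).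
Local Notation mu := (@lebesgue_measure R).
Local Notation I01 := (`]0%R, 1%R[%classic : set (measurableTypeR R)).

Lemma derive1n_affine n c d phi : (forall m x, derivable (derive1n m phi) x 1) ->
  derive1n n (fun x => phi (c * x + d)) = (fun x => c ^+ n * derive1n n phi (c * x + d)).
Proof.
move=> dphi; elim: n => [|n IH]; first by apply/funext => x; rewrite expr0 mul1r.
rewrite derive1nS IH; apply/funext => x; rewrite derive1E.
have h1 : is_derive (c * x + d) 1 (derive1n n phi) (derive1n n.+1 phi (c * x + d)).
  by rewrite derive1nS derive1E; apply: DeriveDef.
have h2 := @is_derive1_comp _ (derive1n n phi) _ x _ _ h1 (is_derive_affine c d x).
have [_ ->] := is_derive_mul (is_derive_cst (c ^+ n) x 1) h2.
by rewrite mul0r add0r exprS /cst; ring.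
Qed.

Lemma test_function_affine s t phi : 0 <= s -> s < t -> t <= 1 -> test_function phi ->
  test_function (fun x => phi ((t - s)^-1 * x - (t - s)^-1 * s)).
Proof.
move=> s0 st t1 [dphi [K [cK KI phi0]]].
have ts : 0 < t - s by rewrite subr_gt0.
split=> [n x|].
  rewrite (derive1n_affine _ _ _ dphi).
  have h1 : is_derive ((t - s)^-1 * x - (t - s)^-1 * s) 1 (derive1n n phi)
    (derive1n n.+1 phi ((t - s)^-1 * x - (t - s)^-1 * s)).
    by rewrite derive1nS derive1E; apply: DeriveDef.
  have h2 := @is_derive1_comp _ (derive1n n phi) _ x _ _ h1 (is_derive_affine (t - s)^-1 (- ((t - s)^-1 * s)) x).
  by have [] := is_derive_mul (is_derive_cst ((t - s)^-1 ^+ n) x 1) h2.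
exists ((fun y => (t - s) * y + s) @` K); split.
- apply: continuous_compact => //; apply: continuous_subspaceT => y.
  by apply: cvgD; [apply: cvgM; [exact: cvg_cst|exact: cvg_id]|exact: cvg_cst].
- move=> _ [y /KI + <-]; rewrite /= !in_itv/= => /andP[y0 y1]; apply/andP; split; nra.
- move=> x hx; apply: phi0 => Kx; apply: hx; exists ((t - s)^-1 * x - (t - s)^-1 * s) => //.
  by field; rewrite gt_eqF.
Qed.

(** Cutoffs of the constant 1, transported affinely from (0, 1) to (s, t), are test functions that
    converge boundedly to the indicator of (s, t). *)
Lemma weak_zero_int_eq0 h s t : locally_integrable I01 h ->
  (forall phi, test_function phi -> int01 (fun x => h x * phi x) = 0) ->
  0 < s -> s < t -> t < 1 ->
  mu.-integrable `[s, t] (EFin \o h) /\ \int[mu]_(x in `[s, t]) h x = 0.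
Proof.
move=> [mh _ hK] hphi s0 st t1; have ts : 0 < t - s by rewrite subr_gt0.
have stI : `[s, t]%classic `<=` I01.
  by move=> x /=; rewrite !in_itv/= => /andP[h1 h2]; rewrite (lt_le_trans s0 h1) (le_lt_trans h2 t1).
have sooI : `]s, t[%classic `<=` I01.
  by apply: subset_trans stI; exact: subset_itv_oo_cc.
have ih : mu.-integrable `[s, t] (EFin \o h).
  apply/integrableP; split; last by apply: hK => //; exact: segment_compact.
  by apply/measurable_EFinP; apply: measurable_funS mh.
have iho : mu.-integrable `]s, t[ (EFin \o h).
  by apply: integrableS ih => //; exact: subset_itv_oo_cc.
split => //.
have <- : \int[mu]_(x in `]s, t[) h x = \int[mu]_(x in `[s, t]) h x.
  rewrite /Rintegral (integral_itv_bndoo true false)//.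
  by apply/measurable_EFinP; apply: measurable_funS mh.
have -> : `]s, t[%classic = I01 `&` `]s, t[ by rewrite setIidr.
rewrite Rintegral_mkcondr -/(int01 _).
have [F FP] := cutoff_exists (1 : {poly R}).
have [C C0 hC] := cutoff_bounded FP.
pose y x := (t - s)^-1 * x - (t - s)^-1 * s.
have yE x : y x = (x - s) / (t - s) by rewrite /y -mulrBr mulrC.
(* The factor [rho 0 0] is the constant 1; it gives the cutoff the shape expected by
   [cutoff_test]. *)
pose phi n x := rho 0 0 (y x) * F n (y x).
have tphi n : test_function (phi n).
  by apply: (@test_function_affine s t (fun z => rho 0 0 z * F n z)); rewrite ?ltW//; exact: cutoff_test FP.
have rho1 z : rho 0 0 z = 1 by rewrite /rho !powRr0 mulr1.
have y01 x : s < x < t -> 0 < y x < 1.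
  by move=> /andP[h1 h2]; rewrite yE divr_gt0 ?subr_gt0//= ltr_pdivrMr// mul1r ltrD2r.
have phi_out n x : ~~ (s < x < t) -> phi n x = 0.
  move=> xst; rewrite /phi (cutoff_support FP) ?mulr0//; apply/orP.
  move: xst; rewrite negb_and -!leNgt => /orP[h1|h1]; [left|right].
    rewrite (@le_trans _ _ 0)// mulr_ge0_le0// yE mulr_le0_ge0 ?subr_le0// invr_ge0 ltW//.
  rewrite (@le_trans _ _ 0)// mulr_ge0_le0// subr_le0 yE ler_pdivlMr// mul1r lerD2r//.
(* Being only locally integrable, [h] cannot dominate on (0, 1); its restriction to [s, t] can. *)
pose hst := h \_ `[s, t]%classic.
have ihst : itg hst.
  by rewrite /itg -restrict_EFin; apply/integrable_restrict => //; rewrite setIidr.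
have mphi n : measurable_fun I01 (fun x => hst x * phi n x).
  apply: measurable_funM; first exact: itg_measurable.
  by apply: continuous_measurable01; apply: test_function_continuous.
have bnd n x : 0 < x < 1 -> `|hst x * phi n x| <= C * `|hst x|.
  move=> x01; rewrite normrM mulrC ler_wpM2r//.
  have [xst|xst] := boolP (s < x < t); last by rewrite phi_out// normr0.
  by rewrite /phi rho1 mul1r hC//; have /andP[h1 h2] := y01 _ xst; rewrite !ltW.
have ptw x : 0 < x < 1 -> hst x * phi n x @[n --> \oo] --> (h \_ `]s, t[%classic) x.
  move=> x01; have [xst|xst] := boolP (s < x < t); last first.
    rewrite patchE memNset; last by rewrite /= in_itv/=; exact/negP.
    apply: (@cvg_trans _ ((fun=> (0 : R)) @ \oo)); last exact: cvg_cst.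
    by apply: near_eq_cvg; apply: nearW => n; rewrite phi_out// mulr0.
  have -> : (h \_ `]s, t[%classic) x = hst x * (1%:P).[y x].
    rewrite hornerC mulr1 /hst !patchE !mem_set//= in_itv//=.
    by have /andP[h1 h2] := xst; rewrite !ltW.
  apply: cvgM; first exact: cvg_cst.
  apply: cvg_trans (cutoff_cvg FP (y01 _ xst)).
  by apply: near_eq_cvg; apply: nearW => n; rewrite /phi rho1 mul1r.
have [_] := int01_dominated mphi (itgZ C (itg_norm ihst)) bnd ptw.
move=> cv; apply: (cvg_unique (@norm_hausdorff _ R) cv).
apply: (@cvg_trans _ ((fun=> (0 : R)) @ \oo)); last exact: cvg_cst.
apply: near_eq_cvg; apply: nearW => n /=.
rewrite -[LHS](hphi _ (tphi n)); apply: int01_eq => x x01.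
have [xst|xst] := boolP (s < x < t); last by rewrite phi_out// !mulr0.
rewrite /hst patchE mem_set//= in_itv/=.
by have /andP[h1 h2] := xst; rewrite !ltW.
Qed.

(** All integrals over inner intervals vanish, so the primitive of [h] is locally 0, and Lebesgue
    differentiation recovers [h] almost everywhere. Countably many inner intervals exhaust (0,
    1). *)
Lemma weak_zero_ae h : locally_integrable I01 h ->
  (forall phi, test_function phi -> int01 (fun x => h x * phi x) = 0) ->
  {ae mu, forall x, I01 x -> h x = 0}.
Proof.
move=> lh hphi.
pose c (k : nat) : R := k.+3%:R^-1.
have c0 k : 0 < c k by rewrite invr_gt0.
have c3 k : c k <= 3^-1 by rewrite lef_pV2 ?posrE// ler_nat.
suff H k : {ae mu, forall x, c k < x < 1 - c k -> h x = 0}.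
  have := ae_foralln H.
  apply: (@filterS _ _ (ae_filter_ringOfSetsType mu)) => x /= hx xI.
  have /andP[x0 x1] := in01 xI.
  have m0 : 0 < Num.min x (1 - x) by rewrite lt_min x0 subr_gt0.
  pose N := Num.truncn (Num.min x (1 - x))^-1.
  have h1 : (Num.min x (1 - x))^-1 < N.+1%:R by rewrite truncnS_gt.
  have h2 : c N < Num.min x (1 - x).
    rewrite -[ltRHS]invrK ltf_pV2 ?posrE ?invr_gt0// (lt_le_trans h1)// ler_nat.
    by apply: leqW.
  apply: (hx N); move: h2; rewrite lt_min => /andP[-> h2] /=.
  by rewrite ltrBrDr -ltrBrDl.
have ck1 : c k < 1 - c k by move: (c0 k) (c3 k); lra.
have [ick _] := weak_zero_int_eq0 lh hphi (c0 k) ck1 (ltac:(by move: (c0 k); lra)).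
pose hh := h \_ `[c k, 1 - c k]%classic.
have ihh : mu.-integrable setT (EFin \o hh).
  by rewrite -restrict_EFin; apply/integrable_restrict => //; rewrite setTI.
pose F x := \int[mu]_(z in `[c k, x]) hh z.
have F0 x : c k < x -> x < 1 - c k -> F x = 0.
  move=> h1 h2; have := c0 k => h0; have x1 : x < 1 by lra.
  have [_ <-] := weak_zero_int_eq0 lh hphi (c0 k) h1 x1.
  rewrite /F; apply: eq_Rintegral => z /set_mem; rewrite /= in_itv/= => /andP[z1 z2].
  by rewrite /hh patchE mem_set//= in_itv/= z1 (le_trans z2)// ltW.
have i1 y : mu.-integrable `[c k, y] (EFin \o hh) by apply: integrableS ihh.
have i2 : locally_integrable setT hh by apply: open_integrable_locally => //; exact: openT.
have := FTC1 i1 i2; rewrite -/F.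
apply: (@filterS _ _ (ae_filter_ringOfSetsType mu)) => x /= hx /andP[h1 h2].
have [_] := hx (ltac:(by rewrite lte_fin)).
rewrite /hh patchE mem_set; last by rewrite /= in_itv/= !ltW.
move=> <-; rewrite derive1E (@near_eq_derive _ _ _ _ (cst 0)) ?derive_cst//.
near=> z; apply: F0; near: z; [exact: lt_nbhsr|exact: lt_nbhsl].
Unshelve. all: by end_near. Qed.

Lemma weak_derivative_unique l u g1 g2 : weak_derivative l u g1 -> weak_derivative l u g2 ->
  {ae mu, forall x, I01 x -> g1 x = g2 x}.
Proof.
move=> [_ l1 h1] [_ l2 h2].
have lB : locally_integrable I01 (fun x => g1 x - g2 x) := locally_integrableB l1 l2.
have hB phi : test_function phi -> int01 (fun x => (g1 x - g2 x) * phi x) = 0.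
  move=> tphi.
  have tint g : locally_integrable I01 g -> itg (fun x => g x * phi x).
    move=> [mg _ hg]; have [_ [K [cK KI phi0]]] := tphi.
    have mK : measurable (K : set (measurableTypeR R)) by exact: compact_measurable.
    have cphi := test_function_continuous tphi.
    have [C C0 hC] := continuous_compact_bound cK (continuous_subspaceT cphi).
    have iK : itg (g \_ K).
      rewrite /itg -restrict_EFin; apply/integrable_restrict => //; rewrite setIidr//.
      apply/integrableP; split; last exact: hg.
      by apply/measurable_EFinP; apply: measurable_funS mg.
    have mphi : measurable_fun I01 phi by exact: continuous_measurable01.
    apply: le_itg (itgZ C (itg_norm iK)); first exact: measurable_funM.
    move=> x _; rewrite normrM mulrC; have [xK|xK] := pselect (K x).
      by rewrite patchE mem_set// ler_wpM2r// hC.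
    by rewrite phi0// normr0 mul0r mulr_ge0.
  have i1 := tint _ l1; have i2 := tint _ l2.
  rewrite (_ : int01 _ = int01 (fun x => g1 x * phi x) - int01 (fun x => g2 x * phi x)); last first.
    by rewrite -int01B//; apply: int01_eq => x _; rewrite mulrBl.
  apply/eqP; rewrite subr_eq0; apply/eqP.
  have s0 : (-1) ^+ l != 0 :> R by rewrite signr_eq0.
  by apply: (mulfI s0); rewrite -[LHS](h1 _ tphi) -[RHS](h2 _ tphi).
have := weak_zero_ae lB hB.
apply: (@filterS _ _ (ae_filter_ringOfSetsType mu)) => x /= hx xI.
by apply/eqP; rewrite -subr_eq0; apply/eqP; exact: hx.
Qed.

(** Replaces the unspecified representative [weakD] by any weak derivative constructed by hand. *)
Lemma L2norm_weakD l u g a b : weak_derivative l u g ->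
  L2norm (rho a b) (weakD l u) = L2norm (rho a b) g.
Proof.
move=> ug; have uD : weak_derivative l u (weakD l u) by apply: getPex; exists g.
have [[_ [mD _ _] _] [_ [mg _ _] _]] := (uD, ug).
rewrite /L2norm; congr sqrte; apply: ae_eq_integral => //.
- apply/measurable_EFinP; apply: measurable_funM; first exact: measurable_rho.
  exact: measurable_funX.
- apply/measurable_EFinP; apply: measurable_funM; first exact: measurable_rho.
  exact: measurable_funX.
apply: (@filterS _ _ (ae_filter_ringOfSetsType mu) _ _ _ (weak_derivative_unique uD ug)).
by move=> x /= hx xI; rewrite hx.
Qed.

End WeakDerivativeUniqueness.

(** * Jacobi series and their weak derivatives *)

Section JacobiSeries.
Variable R : realType.
Implicit Types (a b c x y z : R) (P Q : {poly R}) (f g h u v : R -> R) (e : nat -> R).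
Local Notation mu := (@lebesgue_measure R).
Local Notation I01 := (`]0%R, 1%R[%classic : set (measurableTypeR R)).

Definition jacobi_sum a b e (n : nat) : {poly R} :=
  \sum_(i < n) e i *: shifted_jacobi i a b.

Lemma gtN1_addn a (l : nat) : -1 < a -> -1 < a + l%:R.
Proof. by move=> a1; rewrite (lt_le_trans a1)// lerDl. Qed.

Lemma jacobi_sum_derivn a b e n l :
  (jacobi_sum a b e n)^`(l) = \sum_(i < n) e i *: (shifted_jacobi i a b)^`(l).
Proof.
rewrite /jacobi_sum (big_morph (derivn l) (@derivnD R l) (_ : 0^`(l) = 0)).
  by apply: eq_bigr => i _; rewrite derivnZ.
by elim: l => [|l IH]; rewrite ?derivn0// derivnS IH deriv0.
Qed.

Lemma sqnorm_dot a b P : sqnorm a b (horner P) = dot a b P P.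
Proof. by apply: int01_eq => x _; rewrite hornerM expr2. Qed.

Lemma dot_jacobi_sum_derivn a b e n l m : -1 < a -> -1 < b -> (m < n)%N ->
  dot (a + l%:R) (b + l%:R) ((jacobi_sum a b e n)^`(l)) ((shifted_jacobi m a b)^`(l)) =
  e m * (jacobi_eigen l m (a + b) * jacobi_sqnorm m a b).
Proof.
move=> a1 b1 mn; have al := gtN1_addn l a1; have bl := gtN1_addn l b1.
rewrite jacobi_sum_derivn (dot_suml n (fun i => e i *: (shifted_jacobi i a b)^`(l)))//.
rewrite (bigD1 (Ordinal mn))//= big1 ?addr0 => [|i im]; last first.
  rewrite dotZl// dot_derivn_shifted_jacobi// (_ : (i : nat) == m = false) ?mul0r ?mulr0//.
  by apply/negbTE; move: im; rewrite -val_eqE.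
by rewrite dotZl// dot_derivn_shifted_jacobi// eqxx mul1r.
Qed.

Lemma sqnorm_jacobi_sum_derivn a b e n l : -1 < a -> -1 < b ->
  sqnorm (a + l%:R) (b + l%:R) (horner ((jacobi_sum a b e n)^`(l))) =
  \sum_(i < n) e i ^+ 2 * (jacobi_eigen l i (a + b) * jacobi_sqnorm i a b).
Proof.
move=> a1 b1; have al := gtN1_addn l a1; have bl := gtN1_addn l b1.
rewrite sqnorm_dot [in X in dot _ _ X _]jacobi_sum_derivn.
rewrite (dot_suml n (fun i => e i *: (shifted_jacobi i a b)^`(l)))//.
apply: eq_bigr => i _; rewrite dotZl// dotC dot_jacobi_sum_derivn//; ring.
Qed.

Lemma jacobi_eigen_sqnorm_ge0 a b l n : -1 < a -> -1 < b ->
  0 <= jacobi_eigen l n (a + b) * jacobi_sqnorm n a b.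
Proof.
move=> a1 b1; have := dot_ge0 (a + l%:R) (b + l%:R) ((shifted_jacobi n a b)^`(l)).
by rewrite dot_derivn_shifted_jacobi// eqxx mul1r.
Qed.

(** The test polynomial D^j G_n turns the adjoint operator into the Sturm-Liouville one, with G_n as
    eigenfunction; the two signs (-1)^j cancel. *)
Lemma int01_weakD_shifted_jacobi j f g n a b : -1 < a -> -1 < b ->
  L2w a b f -> L2w (a + j%:R) (b + j%:R) g -> weak_derivative j f g ->
  int01 (fun x => rho (a + j%:R) (b + j%:R) x * (g x * ((shifted_jacobi n a b)^`(j)).[x])) =
  jacobi_eigen j n (a + b) * int01 (fun x => rho a b x * f x * (shifted_jacobi n a b).[x]).
Proof.
move=> a1 b1 fL2 gL2 fg.
have itf := L2w_itg a1 b1 fL2.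
have itg_g := L2w_itg (gtN1_addn j a1) (gtN1_addn j b1) gL2.
have := weak_derivative_rho ((shifted_jacobi n a b)^`(j)) fg itf itg_g.
rewrite rho_derivn_shifted_jacobi => h.
have s1 : (-1) ^+ j * (-1) ^+ j = 1 :> R by rewrite -expr2 sqrr_sign.
rewrite (_ : int01 _ = (-1) ^+ j * ((-1) ^+ j * int01 (fun x => rho (a + j%:R) (b + j%:R) x * g x *
    ((shifted_jacobi n a b)^`(j)).[x]))); last first.
  by rewrite mulrA s1 mul1r; apply: int01_eq => x _; rewrite mulrA.
rewrite -h -int01Z; last exact: itgM_poly.
rewrite -int01Z; last exact: itgM_poly.
apply: int01_eq => x _; rewrite hornerZ.
transitivity ((-1) ^+ j * (-1) ^+ j * jacobi_eigen j n (a + b) * (rho a b x * f x * (shifted_jacobi n a b).[x])).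
  ring.
by rewrite s1 mul1r.
Qed.

(* Bessel's inequality for g in the orthogonal family of the j-th derivatives
   of the Jacobi polynomials, whose coefficients are those of f. *)
Lemma weak_bessel j f g a b e n : -1 < a -> -1 < b ->
  L2w a b f -> L2w (a + j%:R) (b + j%:R) g -> weak_derivative j f g ->
  (forall i, e i * int01 (fun x => rho a b x * f x * (shifted_jacobi i a b).[x]) =
     e i ^+ 2 * jacobi_sqnorm i a b) ->
  \sum_(i < n) e i ^+ 2 * (jacobi_eigen j i (a + b) * jacobi_sqnorm i a b)
    <= sqnorm (a + j%:R) (b + j%:R) g.
Proof.
move=> a1 b1 fL2 gL2 fg he; have aj := gtN1_addn j a1; have bj := gtN1_addn j b1.
set S := \sum_(i < n) _; pose p := (jacobi_sum a b e n)^`(j).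
have pL2 : L2w (a + j%:R) (b + j%:R) (horner p) := L2w_poly p aj bj.
have pS : sqnorm (a + j%:R) (b + j%:R) (horner p) = S by exact: sqnorm_jacobi_sum_derivn.
have gp : int01 (fun x => rho (a + j%:R) (b + j%:R) x * (g x * p.[x])) = S.
  have iF i : itg (fun x => e i * (rho (a + j%:R) (b + j%:R) x * (g x * ((shifted_jacobi i a b)^`(j)).[x]))).
    by apply: itgZ; exact: (L2w_mul gL2 (L2w_poly ((shifted_jacobi i a b)^`(j)) aj bj)).
  rewrite (_ : int01 _ = int01 (fun x => \sum_(i < n) e i * (rho (a + j%:R) (b + j%:R) x *
      (g x * ((shifted_jacobi i a b)^`(j)).[x])))); last first.
    apply: int01_eq => x _; rewrite /p jacobi_sum_derivn horner_sum !mulr_sumr.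
    by apply: eq_bigr => i _; rewrite hornerZ; ring.
  rewrite (int01_sum (F := fun i x => e i * (rho (a + j%:R) (b + j%:R) x *
      (g x * ((shifted_jacobi i a b)^`(j)).[x]))))//.
  apply: eq_bigr => i _; rewrite int01Z; last first.
    exact: (L2w_mul gL2 (L2w_poly ((shifted_jacobi i a b)^`(j)) aj bj)).
  by rewrite (int01_weakD_shifted_jacobi i a1 b1 fL2 gL2 fg) mulrCA he; ring.
have [_ ig] := gL2; have [_ ip] := pL2; have igp := L2w_mul gL2 pL2.
have := sqnorm_ge0 (a + j%:R) (b + j%:R) (fun x => g x - p.[x]).
rewrite (_ : sqnorm _ _ _ = sqnorm (a + j%:R) (b + j%:R) g - 2 * S + S); first by lra.
rewrite -{1}gp -pS /sqnorm -(int01Z 2 igp) -int01B//; last exact: itgZ.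
rewrite -int01D//; last by apply: itgB => //; exact: itgZ.
by apply: int01_eq => x _; ring.
Qed.

Lemma sum_ordB (V : zmodType) (F : nat -> V) n m : (m <= n)%N ->
  \sum_(i < n) F i - \sum_(i < m) F i = \sum_(i < n) (if (i < m)%N then 0 else F i).
Proof.
move=> mn; rewrite (big_ord_widen n F mn) (bigID (fun i : 'I_n => (i < m)%N))/=.
rewrite addrAC subrr add0r big_mkcond/=; apply: eq_bigr => i _.
by case: (i < m)%N.
Qed.

(** A difference of partial sums is again a partial sum, with its first coefficients set to 0, so
    the norm formula also applies to tails. *)
Lemma jacobi_sumB a b e n m : (m <= n)%N ->
  jacobi_sum a b e n - jacobi_sum a b e m =
  jacobi_sum a b (fun i => if (i < m)%N then 0 else e i) n.
Proof.
move=> mn; rewrite /jacobi_sum (sum_ordB (fun i => e i *: shifted_jacobi i a b) mn).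
by apply: eq_bigr => i _; case: ifPn; rewrite ?scale0r.
Qed.

(** By orthogonality the squared distances between differentiated partial sums are increments of the
    bounded increasing sequence [T]. They are thus Cauchy, and their limit is the weak
    derivative. *)
Lemma weak_derivative_jacobi_series l a b e u M : -1 < a -> -1 < b -> L2w a b u ->
  sqnorm a b (fun x => u x - (jacobi_sum a b e n).[x]) @[n --> \oo] --> (0 : R) ->
  (forall n, \sum_(i < n) e i ^+ 2 * (jacobi_eigen l i (a + b) * jacobi_sqnorm i a b) <= M) ->
  exists2 g, weak_derivative l u g &
    L2w (a + l%:R) (b + l%:R) g /\ sqnorm (a + l%:R) (b + l%:R) g <= M.
Proof.
move=> a1 b1 uL2 pu hM; have al := gtN1_addn l a1; have bl := gtN1_addn l b1.
pose T n := \sum_(i < n) e i ^+ 2 * (jacobi_eigen l i (a + b) * jacobi_sqnorm i a b).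
have T_nd : nondecreasing_seq T.
  apply/nondecreasing_seqP => n; rewrite /T big_ord_recr/= lerDl.
  by rewrite mulr_ge0 ?sqr_ge0// jacobi_eigen_sqnorm_ge0.
have cT : cvgn T.
  by apply: nondecreasing_is_cvgn => //; exists M => _ [n _ <-]; exact: hM.
have Tlim n : T n <= limn T by exact: nondecreasing_cvgn_le.
pose s n := horner ((jacobi_sum a b e n)^`(l)).
have sL2 n : L2w (a + l%:R) (b + l%:R) (s n) by exact: L2w_poly.
have sB n m : (m <= n)%N -> sqnorm (a + l%:R) (b + l%:R) (fun x => s n x - s m x) = T n - T m.
  move=> mn.
  rewrite (_ : (fun x => _) = horner ((jacobi_sum a b (fun i => if (i < m)%N then 0 else e i) n)^`(l))); last first.
    by apply/funext => x; rewrite -jacobi_sumB// derivnB hornerD hornerN.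
  rewrite sqnorm_jacobi_sum_derivn// /T.
  rewrite (sum_ordB (fun i => e i ^+ 2 * (jacobi_eigen l i (a + b) * jacobi_sqnorm i a b)) mn).
  by apply: eq_bigr => i _; case: ifPn; rewrite ?expr0n ?mul0r.
have cauchy eps : 0 < eps -> exists N, forall n m, (N <= n)%N -> (N <= m)%N ->
    sqnorm (a + l%:R) (b + l%:R) (fun x => s n x - s m x) <= eps.
  move=> eps0; have /cvgrPdist_le/(_ _ eps0) [N _ hN] := cT.
  exists N.
  suff H n m : (N <= m)%N -> (m <= n)%N ->
      sqnorm (a + l%:R) (b + l%:R) (fun x => s n x - s m x) <= eps.
    move=> n m Nn Nm; have [mn|nm] := leqP m n; first exact: H.
    rewrite (_ : sqnorm _ _ _ = sqnorm (a + l%:R) (b + l%:R) (fun x => s m x - s n x)).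
      exact: H (ltnW nm).
    by apply: int01_eq => x _; congr (_ * _); ring.
  move=> Nm mn; rewrite sB//.
  have := hN m Nm; rewrite /= ger0_norm ?subr_ge0//.
  by have := Tlim n; lra.
have [g gL2 sg] := riesz_fischer al bl sL2 cauchy.
have sgC : sqnorm (a + l%:R) (b + l%:R) (fun x => g x - ((jacobi_sum a b e n)^`(l)).[x])
   @[n --> \oo] --> (0 : R) by exact: sg.
exists g; first exact: (weak_derivative_limit a1 b1 uL2 gL2 pu sgC).
split => //.
(* From (s + w)^2 <= (1 + t) s^2 + (1 + 1/t) w^2: letting n grow and then t tend to 0 keeps the
   bound [M] without loss. *)
have bound t n : 0 < t -> sqnorm (a + l%:R) (b + l%:R) g <=
    (1 + t) * M + (1 + t^-1) * sqnorm (a + l%:R) (b + l%:R) (fun x => g x - s n x).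
  move=> t0; have [_ i1] := sL2 n; have [_ i2] := L2wB gL2 (sL2 n); have [_ i0] := gL2.
  have sM : sqnorm (a + l%:R) (b + l%:R) (s n) <= M.
    by rewrite /s sqnorm_jacobi_sum_derivn//; exact: hM.
  apply: (@le_trans _ _ ((1 + t) * sqnorm (a + l%:R) (b + l%:R) (s n) +
      (1 + t^-1) * sqnorm (a + l%:R) (b + l%:R) (fun x => g x - s n x))); last first.
    by rewrite lerD2r ler_wpM2l// addr_ge0 ?ler01 ?ltW.
  have i1' := itgZ (1 + t) i1; have i2' := itgZ (1 + t^-1) i2.
  rewrite /sqnorm -(int01Z (1 + t) i1) -(int01Z (1 + t^-1) i2) -(int01D i1' i2').
  apply: le_int01 => //; first exact: itgD.
  move=> x _; move: (rho _ _ x) (rho_ge0 (a + l%:R) (b + l%:R) x) => r r0.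
  rewrite (_ : _ + _ = r * ((1 + t) * s n x ^+ 2 + (1 + t^-1) * (g x - s n x) ^+ 2)); last by ring.
  rewrite ler_wpM2l// -subr_ge0.
  rewrite (_ : _ - _ = t^-1 * (t * s n x - (g x - s n x)) ^+ 2); last by field; rewrite gt_eqF.
  by rewrite mulr_ge0 ?sqr_ge0// invr_ge0 ltW.
have bound2 t : 0 < t -> sqnorm (a + l%:R) (b + l%:R) g <= (1 + t) * M.
  move=> t0.
  have lim : (1 + t) * M + (1 + t^-1) * sqnorm (a + l%:R) (b + l%:R) (fun x => g x - s n x)
     @[n --> \oo] --> (1 + t) * M + (1 + t^-1) * 0.
    by apply: cvgD; [exact: cvg_cst|apply: cvgM => //; exact: cvg_cst].
  rewrite mulr0 addr0 in lim.
  rewrite -(cvg_lim (@norm_hausdorff _ R) lim); apply: limr_ge.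
    by apply/cvg_ex; eexists; exact: lim.
  by apply: nearW => n; exact: bound.
apply/ler_addgt0Pr => t t0.
have M0 : 0 <= M by have := hM 0%N; rewrite big_ord0.
have M1 : 0 < M + 1 by rewrite ltr_pwDr.
(* This choice makes the excess t M / (M + 1) at most t; the added 1 covers M = 0. *)
apply: (le_trans (bound2 (t / (M + 1)) _)); first by rewrite divr_gt0.
rewrite mulrDl mul1r lerD2l -mulrA ler_piMr ?(ltW t0)// mulrC ler_pdivrMr// mul1r lerDl//.
Qed.

End JacobiSeries.

(** * Lower bound for the Gamma quotient *)

Section Constants.
Variable R : realType.
Implicit Types (a b s t x y z M : R) (P Q : {poly R}).
Local Notation mu := (@lebesgue_measure R).
Local Notation Ioo := (`]0%R, +oo[%classic : set (measurableTypeR R)).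

Lemma horner_expRN_cvg0 P : P.[t] * expR (- t) @[t --> +oo] --> (0 : R).
Proof.
have [C C0 hC] := horner_expRN_bounded (P * 'X).
have lim : C / t @[t --> +oo] --> (0 : R).
  rewrite -[X in _ --> X](mulr0 C); apply: cvgM; first exact: cvg_cst.
  apply/(@gtr0_cvgV0 _ _ _ _ id); last exact: cvg_id.
  by near=> y.
apply: norm_cvg0; apply: (@squeeze_cvgr _ _ _ _ (fun=> 0) (fun t => C / t)) => //; last exact: cvg_cst.
near=> t; have t0 : 0 < t by [].
rewrite normr_ge0/= ler_pdivlMr//; have := hC t (ltW t0).
by rewrite hornerMX mulrAC normrM (ger0_norm (ltW t0)).
Unshelve. all: by end_near. Qed.

(** The sum of (n! / k!) X^k over k <= n, which solves P - P' = X^n; hence -P(t) exp(-t) is a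
    primitive of t^n exp(-t). *)
Fixpoint gamma_poly (n : nat) : {poly R} :=
  if n is m.+1 then 'X ^+ n + n%:R *: gamma_poly m else 1.

Lemma gamma_poly_deriv n : gamma_poly n - (gamma_poly n)^`()%R = 'X ^+ n.
Proof.
suff H m : (gamma_poly m.+1)^`()%R = m.+1%:R *: gamma_poly m.
  by case: n => [|n]; [rewrite /= -polyC1 derivC subr0 polyC1|rewrite H /= addrK].
elim: m => [|m IH].
  by rewrite /= expr1 derivD derivX derivZ -polyC1 derivC scaler0 addr0 scale1r.
have -> : gamma_poly m.+2 = 'X ^+ m.+2 + m.+2%:R *: gamma_poly m.+1 by [].
by rewrite derivD derivXn derivZ IH -scaler_nat /= -scalerDr.
Qed.

Lemma gamma_poly0 n : (gamma_poly n).[0] = n`!%:R.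
Proof.
elim: n => [|n IH]; first by rewrite /= hornerC.
by rewrite /= hornerD hornerXn expr0n/= add0r hornerZ IH factS natrM.
Qed.

Lemma int_Xn_expRN n :
  mu.-integrable Ioo (EFin \o (fun t => t ^+ n * expR (- t))) /\
  \int[mu]_(t in Ioo) (t ^+ n * expR (- t)) = n`!%:R.
Proof.
pose F t := (- gamma_poly n).[t] * expR (- t).
have dF x : is_derive x 1 F (x ^+ n * expR (- x)).
  have dE : is_derive x 1 (fun z : R => expR (- z)) (expR (- x) * -1).
    have dN : is_derive x 1 (fun z : R => - z) (-1) by exact: is_deriveNid.
    exact: (@is_derive1_comp _ expR _ x _ _ (is_derive_expR _) dN).
  apply: is_derive_eq (is_derive_mul (is_derive_poly (- gamma_poly n) x) dE) _.
  rewrite -[x ^+ n]hornerXn -gamma_poly_deriv derivN !hornerD !hornerN; ring.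
have cf : continuous (fun t : R => t ^+ n * expR (- t)).
  move=> t; apply: cvgM; first exact: exprn_continuous.
  by apply: (cvg_comp (fun t : R => - t) expR); [apply: cvgN; exact: cvg_id|exact: continuous_expR].
have mf (D : set (measurableTypeR R)) : measurable_fun D (fun t : R => t ^+ n * expR (- t)).
  by apply: (@measurable_funS _ _ _ _ setT) => //; exact: continuous_measurable_fun.
have E : (\int[mu]_(t in Ioo) (t ^+ n * expR (- t))%:E = n`!%:R%:E)%E.
  rewrite integral_itv_obnd_cbnd; last by apply/measurable_EFinP; exact: mf.
  rewrite (@ge0_continuous_FTC2y _ _ F _ 0).
  - by rewrite /F oppr0 expR0 mulr1 hornerN gamma_poly0 -EFinB sub0r opprK.
  - by move=> x x0; rewrite mulr_ge0 ?exprn_ge0 ?expR_ge0.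
  - exact: continuous_subspaceT.
  - exact: horner_expRN_cvg0.
  - by move=> x _; have [] := dF x.
  - apply: cvg_at_right_filter; have [h _] := dF 0.
    by apply/differentiable_continuous/derivable1_diffP.
  - by move=> x _; rewrite derive1E; have [_ ->] := dF x.
split; last by rewrite /Rintegral E.
apply/integrableP; split; first exact/measurable_EFinP.
rewrite (@eq_integral _ _ _ mu Ioo (fun t => (t ^+ n * expR (- t))%:E)) ?E ?ltry//.
move=> x /set_mem; rewrite /= in_itv/= andbT => x0.
by rewrite ger0_norm// mulr_ge0 ?exprn_ge0 ?expR_ge0// ltW.
Qed.

(** For x <= 1 the power is at least x; for x > 1 it is at least 1, the maximum of x - x^2 / 4,
    attained at x = 2. *)
Lemma powR_ge_quadratic x s : 0 <= s <= 1 -> 0 < x -> x * (1 - x / 4) <= x `^ s.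
Proof.
move=> /andP[s0 s1] x0; have [x1|x1] := leP x 1.
  apply: (@le_trans _ _ x); last by apply: ger1_powR => //; rewrite x0.
  by rewrite ler_piMr ?ltW//; lra.
apply: (@le_trans _ _ 1).
  rewrite -subr_ge0 (_ : _ - _ = (x / 2 - 1) ^+ 2) ?sqr_ge0//; by field.
by rewrite -(powRr0 x); apply: ler_powR => //; exact: ltW.
Qed.

(* Bounding t^s from below by (i+1)^s times a quadratic in t/(i+1) leaves only
   factorials to integrate. *)
Lemma Gamma_lower_bound (i : nat) s : 0 < s < 1 ->
  i.+1%:R `^ s / 2 <= Gamma (i%:R + (1 + s)) / i`!%:R.
Proof.
move=> /andP[s0 s1].
have fi0 : 0 < i`!%:R :> R by rewrite ltr0n fact_gt0.
rewrite ler_pdivlMr//.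
have mo : measurable Ioo by exact: measurable_itv.
pose m : R := i.+1%:R; have m0 : 0 < m by rewrite ltr0n.
have [i1 e1] := int_Xn_expRN i.+1; have [i2 e2] := int_Xn_expRN i.+2.
have [i0 _] := int_Xn_expRN i.
have pw t : 0 < t -> t `^ (i%:R + (1 + s) - 1) = t ^+ i * t `^ s.
  move=> t0; rewrite (_ : _ - 1 = i%:R + s); last by ring.
  by rewrite powRD ?(gt_eqF t0) ?implybT// powR_mulrn// ltW.
have mG : measurable_fun Ioo (fun t => t `^ (i%:R + (1 + s) - 1) * expR (- t)).
  apply: measurable_funM; first by apply: (@measurable_funS _ _ _ _ setT) => //; exact: measurable_powR.
  apply: measurableT_comp => //.
(* Dominated through t^s <= 1 + t. *)
have iG : mu.-integrable Ioo (EFin \o (fun t => t `^ (i%:R + (1 + s) - 1) * expR (- t))).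
  have i01 := integrableD mo i0 i1.
  apply: (le_integrable _ _ _ i01) => //; first exact/measurable_EFinP.
  move=> t; rewrite /= in_itv/= andbT => t0; rewrite lee_fin.
  have e0 := expR_ge0 (- t); have t0' := ltW t0.
  rewrite !ger0_norm ?addr_ge0 ?mulr_ge0 ?exprn_ge0 ?powR_ge0// pw// -mulrDl ler_wpM2r//.
  rewrite exprSr -[X in _ <= X + _]mulr1 -mulrDr ler_wpM2l ?exprn_ge0//.
  have [t1|t1] := leP t 1.
    by rewrite (le_trans (powR_le1 (ltW s0) _)) ?t0// lerDl.
  by rewrite (le_trans (ler1_powR (ltW t1) (ltW s1)))// lerDr.
have k1 := integrableZl mo (m `^ s / m) i1.
have k2 := integrableZl mo (m `^ s / (4 * m ^+ 2)) i2.
have k3 := integrableB mo k1 k2.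
(* This integral equals m^s i! (3 m - 1) / (4 m), which is at least m^s i! / 2 because m >= 1. *)
apply: (@le_trans _ _ (\int[mu]_(t in Ioo) (m `^ s / m * (t ^+ i.+1 * expR (- t)) -
    m `^ s / (4 * m ^+ 2) * (t ^+ i.+2 * expR (- t))))).
  rewrite RintegralB// RintegralZl// RintegralZl// e1 e2 !factS !natrM -/m.
  have -> : i.+2%:R = m + 1 :> R by rewrite /m natr1.
  rewrite -subr_ge0 (_ : _ - _ = m `^ s * i`!%:R * (m - 1) / (4 * m)); last by field; rewrite gt_eqF.
  by rewrite !mulr_ge0 ?powR_ge0 ?invr_ge0 ?mulr_ge0 ?(ltW m0) ?(ltW fi0)// subr_ge0 ler1n.
apply: le_Rintegral => // t; rewrite /= in_itv/= andbT => t0.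
have tm0 : 0 < t / m by rewrite divr_gt0.
rewrite pw// (_ : t `^ s = m `^ s * (t / m) `^ s); last first.
  by rewrite -powRM ?(ltW m0) ?(ltW tm0)//; congr (_ `^ _); field; rewrite gt_eqF.
rewrite (_ : _ - _ = t ^+ i * (m `^ s * (t / m * (1 - t / m / 4))) * expR (- t)); last first.
  by rewrite !exprSr; field; rewrite gt_eqF.
rewrite ler_wpM2r ?expR_ge0// ler_wpM2l ?exprn_ge0 ?(ltW t0)// ler_wpM2l ?powR_ge0//.
by apply: powR_ge_quadratic => //; rewrite !ltW.
Qed.

End Constants.

(** * Bounds uniform in alpha for the trigonometric factor and the eigenvalues *)

Section ParameterBounds.
Variable R : realType.
Implicit Types (r alpha beta x y : R).

Lemma cos_sin_half_bounds alpha beta : 1 < alpha < 2 -> alpha - 1 <= beta <= 1 ->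
  0 < sin (pi * (alpha / 2)) /\ 0 < cos (pi * (alpha / 2 - beta)).
Proof.
move=> /andP[a1 a2] /andP[b1 b2]; have p0 := pi_gt0 R.
split; first by apply: sin_gt0_pi; apply/andP; split; nra.
by apply: cos_gt0_pihalf; apply/andP; split; nra.
Qed.

(* With p = pi alpha / 2 and q = pi (alpha / 2 - beta), the constant equals
   cos p / cos q and 2 r - 1 equals - cos p sin q / (sin p cos q). *)
Lemma sin_ratio_sqr r alpha beta : 1 < alpha < 2 -> is_beta r alpha beta ->
  (sin (pi * alpha) / sin_sum alpha beta) ^+ 2 =
  cos (pi * (alpha / 2)) ^+ 2 + (2 * r - 1) ^+ 2 * sin (pi * (alpha / 2)) ^+ 2.
Proof.
move=> a12 [b12 rE]; have [sp cq] := cos_sin_half_bounds a12 b12.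
set p := pi * (alpha / 2) in sp *; set q := pi * (alpha / 2 - beta) in cq *.
have e1 : pi * alpha = p + p by rewrite /p; field.
have e2 : pi * (alpha - beta) = p + q by rewrite /p /q; field.
have e3 : pi * beta = p - q by rewrite /p /q; field.
have sE : sin_sum alpha beta = 2 * (sin p * cos q).
  by rewrite /sin_sum e2 e3 sinD sinB; ring.
have sp0 : sin p != 0 by rewrite gt_eqF.
have cq0 : cos q != 0 by rewrite gt_eqF.
have -> : 2 * r - 1 = - (cos p * sin q) / (sin p * cos q).
  by rewrite rE sE e3 sinB; field; rewrite cq0 sp0.
rewrite sE e1 sinD.
have := cos2Dsin2 q => cs.
transitivity (cos p ^+ 2 * (cos q ^+ 2 + sin q ^+ 2) / cos q ^+ 2); last by field; rewrite cq0 sp0.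
by rewrite cs; field; rewrite cq0 sp0.
Qed.

(** If r > 1/2, then cos^2 + (2 r - 1)^2 sin^2 >= (2 r - 1)^2. Otherwise only cos^2 (pi alpha / 2)
    is kept; the cosine is negative and decreasing for alpha between 1 and 2, so the minimum over
    alpha >= [alpha0] is at [alpha0]. *)
Lemma sin_ratio_lower_bound r alpha0 : 2^-1 <= r <= 1 -> 1 <= alpha0 ->
  (2^-1 < r \/ 1 < alpha0) ->
  exists2 d, 0 < d & forall alpha beta, 1 < alpha < 2 -> alpha0 <= alpha ->
    is_beta r alpha beta -> d ^+ 2 <= (sin (pi * alpha) / sin_sum alpha beta) ^+ 2.
Proof.
move=> /andP[r1 r2] a01 [rgt|agt].
  exists (2 * r - 1); first by lra.
  move=> alpha beta a12 _ hb; rewrite (sin_ratio_sqr a12 hb).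
  have := cos2Dsin2 (pi * (alpha / 2)).
  have := sqr_ge0 (cos (pi * (alpha / 2))).
  move: (cos _ ^+ 2) (sin _ ^+ 2) => c s c0 cs; have cE : c = 1 - s by lra.
  rewrite cE.
  have s1 : s <= 1 by lra.
  rewrite -subr_ge0 (_ : _ - _ = (1 - s) * (1 - (2 * r - 1) ^+ 2)); last by ring.
  by rewrite mulr_ge0 ?subr_ge0// expr_le1//; lra.
(* For [alpha0] >= 2 no admissible alpha exists, and any d serves. *)
have [a02|a02] := ltP alpha0 2; last first.
  by exists 1 => // alpha beta /andP[_ a2] a0a; move: (lt_le_trans a2 a02); lra.
have p0 := pi_gt0 R.
have cneg : cos (pi * (alpha0 / 2)) < 0.
  rewrite -[pi * _](subrK pi) cosDpi oppr_lt0; apply: cos_gt0_pihalf.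
  by apply/andP; split; nra.
exists (- cos (pi * (alpha0 / 2))); first by rewrite oppr_gt0.
move=> alpha beta a12 a0a hb; rewrite (sin_ratio_sqr a12 hb).
have /andP[a1 a2] := a12.
apply: (@le_trans _ _ (cos (pi * (alpha / 2)) ^+ 2)); last by rewrite lerDl mulr_ge0 ?sqr_ge0.
rewrite -[leRHS]sqrrN lerXn2r ?nnegrE ?oppr_ge0 ?(ltW cneg)//; last first.
  rewrite lerN2; move: a0a; rewrite le_eqVlt => /predU1P[->//|a0a].
  apply: ltW; rewrite ltr_cos ?in_itv/=; [nra|apply/andP; split; nra..].
have : cos (pi * (alpha / 2)) <= cos (pi * (alpha0 / 2)).
  move: a0a; rewrite le_eqVlt => /predU1P[->//|a0a].
  apply: ltW; rewrite ltr_cos ?in_itv/=; [nra|apply/andP; split; nra..].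
lra.
Qed.

Lemma jacobi_eigen_ge0 l i x : (l <= i)%N -> 0 <= i%:R + x + 1 -> 0 <= jacobi_eigen l i x.
Proof.
move=> li x0; apply: prodr_ge0 => k _; apply: mulr_ge0; last exact: addr_ge0.
by rewrite subr_ge0 ler_nat (leq_trans _ li)// ltnW.
Qed.

(** Factor by factor, (i-k)(i+alpha+1+k) <= 2 (i+1-k)(i+alpha+k). This moves from the q side (degree
    i) to the f side (degree i + 1). *)
Lemma jacobi_eigen_le l i alpha : 1 < alpha -> (l <= i.+1)%N ->
  jacobi_eigen l i alpha <= 2 ^+ l * jacobi_eigen l i.+1 (alpha - 2).
Proof.
move=> a1 li; rewrite /jacobi_eigen -[X in 2 ^+ X](card_ord l) -prodr_const -big_split/=.
apply: ler_prod => k _.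
have ki : (k%:R : R) <= i%:R by rewrite ler_nat -ltnS (leq_trans (ltn_ord k)).
have k0 := ler0n R k; rewrite -(natr1 i).
move: (k%:R) (i%:R) ki k0 => x y xy x0.
apply/andP; split; first by rewrite mulr_ge0//; lra.
by rewrite mulrCA; apply: ler_pM; lra.
Qed.

(** The factors with index from l to m - 1 are at least 1, those from m to j - 1 at least N (N +
    alpha - 2) / j. Since k < j <= N + 1, no factor vanishes. *)
Lemma jacobi_eigen_growth (l m j i N : nat) alpha : 1 < alpha -> (0 < N)%N -> (N <= i)%N ->
  (l <= m)%N -> (m <= j)%N -> (j <= N.+1)%N ->
  jacobi_eigen l i.+1 (alpha - 2) * (N%:R * (N%:R + alpha - 2)) ^+ (j - m) <=
  j%:R ^+ (j - m) * jacobi_eigen j i.+1 (alpha - 2).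
Proof.
move=> a1 N0 Ni lm mj jN.
pose F (k : nat) : R := (i.+1%:R - k%:R) * (i%:R + alpha + k%:R).
have FE k : (i.+1%:R - k%:R) * (i.+1%:R + (alpha - 2) + 1 + k%:R) = F k.
  by rewrite /F -(natr1 i); ring.
have eS k : jacobi_eigen k.+1 i.+1 (alpha - 2) = jacobi_eigen k i.+1 (alpha - 2) * F k.
  by rewrite /jacobi_eigen big_ord_recr/= FE.
have e0 k : (k <= N.+1)%N -> 0 <= jacobi_eigen k i.+1 (alpha - 2).
  move=> kN; apply: jacobi_eigen_ge0; first by rewrite (leq_trans kN).
  by rewrite -(natr1 i); have := ler0n R i; lra.
have N1 : 1 <= N%:R :> R by rewrite ler1n.
have iN : N%:R <= i%:R :> R by rewrite ler_nat.
have F1 k : (k <= N)%N -> 1 <= F k.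
  move=> kN; have : k%:R <= i%:R :> R by rewrite ler_nat (leq_trans kN).
  have := ler0n R k; rewrite /F -(natr1 i); move: (k%:R) => x x0 xi; nra.
have FX k : (k <= N)%N -> (k < j)%N -> N%:R * (N%:R + alpha - 2) <= j%:R * F k.
  move=> kN kj; have ki : k%:R <= i%:R :> R by rewrite ler_nat (leq_trans kN).
  have kj' : k%:R + 1 <= j%:R :> R by rewrite natr1 ler_nat.
  have k0 := ler0n R k; rewrite /F -(natr1 i).
  move: (k%:R) (j%:R) (i%:R) (N%:R) ki kj' k0 iN N1 => x y z w xz xy x0 wz w1.
  (* Because (k+1)(i+1-k) = i+1 + k(i-k), the factor j makes up for i+1-k being small when k is
     close to i. *)
  have h1 : w <= y * (z + 1 - x) by nra.
  by rewrite mulrA; apply: ler_pM => //; lra.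
have mono : jacobi_eigen l i.+1 (alpha - 2) <= jacobi_eigen m i.+1 (alpha - 2).
  elim: m lm mj => [|m IH]; first by rewrite leqn0 => /eqP ->.
  rewrite leq_eqVlt ltnS => /predU1P[->//|lm] mj.
  apply: (le_trans (IH lm (ltnW mj))); rewrite eS ler_peMr ?e0 ?F1//.
    by rewrite (leq_trans (ltnW mj)).
  by rewrite -ltnS (leq_trans mj).
set X := _ * (_ + _ - _) in FX *.
have X0 : 0 <= X by rewrite /X mulr_ge0//; lra.
apply: (@le_trans _ _ (jacobi_eigen m i.+1 (alpha - 2) * X ^+ (j - m))).
  by rewrite ler_wpM2r ?exprn_ge0.
rewrite -[in jacobi_eigen j _ _](subnKC mj); have : (j - m <= j - m)%N by [].
move: {1 3 4 5}(j - m)%N => d; elim: d => [|d IH] dj; first by rewrite !expr0 mulr1 mul1r addn0.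
have mdj : (m + d < j)%N by rewrite -ltn_subRL.
rewrite addnS eS !exprSr [leLHS]mulrA.
rewrite [leRHS](_ : _ = j%:R ^+ d * jacobi_eigen (m + d) i.+1 (alpha - 2) * (j%:R * F (m + d)%N)); last by ring.
apply: ler_pM => //; first by rewrite mulr_ge0 ?exprn_ge0 ?e0// (leq_trans mj).
  by apply: IH; exact: ltnW.
by apply: FX => //; rewrite -ltnS (leq_trans mdj).
Qed.

End ParameterBounds.

(** * Termwise comparison of the two weighted sums *)

Section ErrorEstimate.
Variable R : realType.
Implicit Types (a b alpha beta d x y z : R) (f g q u v : R -> R).
Local Notation mu := (@lebesgue_measure R).
Local Notation I01 := (`]0%R, 1%R[%classic : set (measurableTypeR R)).

(** By [jacobi_sqnormS] and reflection, i + 1 times the right side is i + alpha times the left side,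
    and alpha > 1. *)
Lemma jacobi_sqnorm_shift alpha beta i : 1 < alpha < 2 -> alpha - 1 <= beta <= 1 ->
  jacobi_sqnorm i (alpha - beta) beta <= jacobi_sqnorm i.+1 (beta - 1) (alpha - beta - 1).
Proof.
move=> /andP[a1 a2] /andP[b1 b2].
have := @jacobi_sqnormS R i (beta - 1) (alpha - beta - 1) (ltac:(lra)) (ltac:(lra)).
rewrite !subrK (jacobi_sqnorm_reflect i).
rewrite (_ : i%:R + _ + _ + 2 = i%:R + alpha); last by ring.
have := dot_ge0 (alpha - beta) beta (shifted_jacobi i (alpha - beta) beta).
rewrite -/(jacobi_sqnorm i (alpha - beta) beta) -(natr1 i) => e0 E.
have i0 := ler0n R i; have i1 : 0 < i%:R + 1 :> R by lra.
rewrite -(ler_pM2l i1) E ler_wpM2r//; lra.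
Qed.

Lemma lambda_lower_bound d alpha beta (i N : nat) : 1 < alpha < 2 ->
  0 < d -> d ^+ 2 <= (sin (pi * alpha) / sin_sum alpha beta) ^+ 2 -> (N <= i)%N ->
  (d * N%:R `^ (alpha - 1) / 2) ^+ 2 <= lambda alpha beta i ^+ 2.
Proof.
move=> /andP[a1 a2] d0 dK Ni; rewrite /lambda [leRHS]exprMn -mulrA exprMn.
apply: ler_pM; rewrite ?sqr_ge0//.
have := @Gamma_lower_bound R i (alpha - 1) (ltac:(lra)).
rewrite (addrC 1) subrK => h.
have h0 : 0 <= N%:R `^ (alpha - 1) / 2 by rewrite divr_ge0 ?powR_ge0.
have h1 : N%:R `^ (alpha - 1) / 2 <= i.+1%:R `^ (alpha - 1) / 2.
  rewrite ler_wpM2r ?invr_ge0//; apply: ge0_ler_powR; rewrite ?nnegrE ?ler0n//; first by lra.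
  by rewrite ler_nat leqW.
have h2 := le_trans h1 h.
by rewrite lerXn2r ?nnegrE// (le_trans h0).
Qed.

(** The constant collects 2^j from the passage to degree i + 1, j^j from the growth of the
    eigenvalues and 4 / d^2 from the lower bound of lambda_i^2. Squaring turns the exponent (m - j)
    / 2 into an integer power. *)
Lemma jacobi_term_bound d alpha beta (N i l m j : nat) :
  1 < alpha < 2 -> alpha - 1 <= beta <= 1 ->
  0 < d -> d ^+ 2 <= (sin (pi * alpha) / sin_sum alpha beta) ^+ 2 ->
  (0 < N)%N -> (N <= i)%N -> (0 < j)%N -> (l <= m)%N -> (m <= j)%N -> (j <= N.+1)%N ->
  jacobi_eigen l i alpha * jacobi_sqnorm i (alpha - beta) beta <=
  (2 ^+ j * j%:R ^+ j * 4 / d ^+ 2) *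
  (N%:R `^ (- (alpha - 1)) * (N%:R * (N%:R + alpha - 2)) `^ ((m%:R - j%:R) / 2)) ^+ 2 *
  (lambda alpha beta i ^+ 2 * (jacobi_eigen j i.+1 (alpha - 2) *
    jacobi_sqnorm i.+1 (beta - 1) (alpha - beta - 1))).
Proof.
move=> a12 b12 d0 dK N0 Ni j0 lm mj jN.
have /andP[a1 a2] := a12.
have N1 : 1 <= N%:R :> R by rewrite ler1n.
set X := N%:R * (N%:R + alpha - 2).
have X0 : 0 < X by rewrite /X mulr_gt0//; lra.
set n1 := N%:R `^ (alpha - 1).
have n10 : 0 < n1 by rewrite powR_gt0//; lra.
have -> : (N%:R `^ (- (alpha - 1)) * X `^ ((m%:R - j%:R) / 2)) ^+ 2 = n1 ^- 2 / X ^+ (j - m).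
  rewrite powRN -/n1 exprMn exprVn; congr (_ * _).
  rewrite -(powR_mulrn 2 (powR_ge0 X _)) -powRrM divfK ?pnatr_eq0//.
  by rewrite -(opprB j%:R) -natrB// powR_invn// ltW.
have lb := lambda_lower_bound a12 d0 dK Ni; rewrite -/n1 in lb.
have eta0 : 0 <= jacobi_sqnorm i (alpha - beta) beta by exact: dot_ge0.
have kap := jacobi_sqnorm_shift i a12 b12.
set eta := jacobi_sqnorm i _ _ in eta0 kap *; set kappa := jacobi_sqnorm _ _ _ in kap *.
have ij : (j <= i.+1)%N by rewrite (leq_trans jN).
have lj : (l <= j)%N by rewrite (leq_trans lm).
have s0 : 0 <= i.+1%:R + (alpha - 2) + 1 :> R by have := ler0n R i.+1; lra.
have El0 := jacobi_eigen_ge0 (leq_trans lj ij) s0.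
have Ej0 := jacobi_eigen_ge0 ij s0.
have E1 := jacobi_eigen_le a1 (leq_trans lj ij).
have E2 := jacobi_eigen_growth a1 N0 Ni lm mj jN; rewrite -/X in E2.
set el := jacobi_eigen l i.+1 _ in El0 E1 E2; set ej := jacobi_eigen j _ _ in Ej0 E2 *.
have Xd0 : 0 < X ^+ (j - m) by rewrite exprn_gt0.
have step1 : jacobi_eigen l i alpha * eta <= 2 ^+ j * el * kappa.
  apply: (@le_trans _ _ (2 ^+ l * el * eta)); first by rewrite ler_wpM2r.
  apply: ler_pM => //; first by rewrite mulr_ge0// exprn_ge0.
  by rewrite ler_wpM2r// ler_eXn2l// ltr1n.
have step2 : el <= j%:R ^+ j * ej / X ^+ (j - m).
  rewrite ler_pdivlMr//; apply: (le_trans E2); rewrite ler_wpM2r//.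
  by rewrite ler_weXn2l ?ler1n// leq_subr.
have k0 : 0 <= kappa by rewrite (le_trans eta0).
apply: (le_trans step1).
apply: (@le_trans _ _ (2 ^+ j * (j%:R ^+ j * ej / X ^+ (j - m)) * kappa)).
  by rewrite ler_wpM2r// ler_wpM2l// exprn_ge0.
have dn : 0 < d ^+ 2 * n1 ^+ 2 / 4 by rewrite divr_gt0// mulr_gt0// exprn_gt0.
rewrite (_ : 2 ^+ j * _ * kappa = 2 ^+ j * j%:R ^+ j * 4 / d ^+ 2 * (n1 ^- 2 / X ^+ (j - m)) *
   ((d * n1 / 2) ^+ 2 * (ej * kappa))); last first.
  by field; rewrite !gt_eqF.
rewrite ler_wpM2l//.
  by rewrite !mulr_ge0 ?invr_ge0 ?exprn_ge0 ?ler0n// ltW.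
by rewrite ler_wpM2r// mulr_ge0.
Qed.

End ErrorEstimate.

(** * The error of the truncated expansion *)

Section ExpansionError.
Variable R : realType.
Implicit Types (a b alpha beta d x y z : R) (f g q u v : R -> R).
Local Notation mu := (@lebesgue_measure R).
Local Notation I01 := (`]0%R, 1%R[%classic : set (measurableTypeR R)).

Lemma rhoN a b x : rho (- a) (- b) x = (rho a b x)^-1.
Proof. by rewrite /rho !powRN invfM. Qed.

Lemma rho_divK a b v x : 0 < x < 1 ->
  rho a b x * (v x / rho a b x) ^+ 2 = rho (- a) (- b) x * v x ^+ 2.
Proof. by move=> x01; rewrite rhoN; field; rewrite gt_eqF// rho_gt0. Qed.

Lemma sqnorm_div_rho a b v : sqnorm a b (fun x => v x / rho a b x) = sqnorm (- a) (- b) v.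
Proof. by apply: int01_eq => x; exact: rho_divK. Qed.

Lemma L2w_div_rho a b v : L2w (- a) (- b) v -> L2w a b (fun x => v x / rho a b x).
Proof.
move=> [mv iv]; split.
  apply: measurable_funM => //.
  rewrite (_ : (fun x => _) = rho (- a) (- b)); first exact: measurable_rho.
  by apply/funext => x; rewrite rhoN.
by apply: itg_eq iv => x x01; rewrite rho_divK.
Qed.

Lemma L2w_rho_poly a b (P : {poly R}) : -1 < a -> -1 < b ->
  L2w (- a) (- b) (fun x => rho a b x * P.[x]).
Proof.
move=> a1 b1; have [_ iP] := L2w_poly P a1 b1; split.
  by apply: measurable_funM; [exact: measurable_rho|exact: measurable_horner].
apply: itg_eq iP => x x01; rewrite rhoN; field; rewrite gt_eqF// rho_gt0//.
Qed.

Lemma cvg_sqnorm (v : nat -> R -> R) a b : (forall n, L2w a b (v n)) ->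
  (fun n => L2norm (rho a b) (v n)) @ \oo --> 0%E -> sqnorm a b (v n) @[n --> \oo] --> (0 : R).
Proof.
move=> vL2 cv.
have c1 : Num.sqrt (sqnorm a b (v n)) @[n --> \oo] --> (0 : R).
  have h : (Num.sqrt (sqnorm a b (v n)))%:E @[n --> \oo] --> (0 : R)%:E.
    apply: cvg_trans cv.
    by apply: near_eq_cvg; apply: nearW => n; rewrite L2normE.
  exact: (fine_cvg h).
have : Num.sqrt (sqnorm a b (v n)) * Num.sqrt (sqnorm a b (v n)) @[n --> \oo] --> (0 * 0 : R).
  exact: cvgM.
rewrite mulr0; apply: cvg_trans; apply: near_eq_cvg; apply: nearW => n.
by rewrite -expr2 sqr_sqrtr// sqnorm_ge0.
Qed.

Definition error_coef alpha beta f (N i : nat) : R :=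
  if (i < N)%N then 0 else ccoef alpha beta f i.

Lemma qN_poly r alpha beta f n x :
  qN r alpha beta f n x = c_m1 r alpha beta f * x * kfun alpha beta x +
  rho (alpha - beta) beta x * (jacobi_sum (alpha - beta) beta (ccoef alpha beta f) n).[x].
Proof.
rewrite /qN horner_sum; congr (_ + _ * _); apply: eq_bigr => i _.
by rewrite hornerZ GpolyE.
Qed.

Lemma qNB r alpha beta f n N x : (N <= n)%N ->
  qN r alpha beta f n x - qN r alpha beta f N x =
  rho (alpha - beta) beta x *
    (jacobi_sum (alpha - beta) beta (error_coef alpha beta f N) n).[x].
Proof.
move=> Nn; rewrite !qN_poly opprD addrACA subrr add0r -mulrBr -hornerN -hornerD.
by rewrite jacobi_sumB.
Qed.

(** The c_{-1} term cancels in q - q_N. Division by rho a beta is an isometry from the space with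
    exponents (-a, -beta), where q is a limit, to the one with (a, beta). *)
Lemma expansion_error_L2 r alpha beta f q N : 1 < alpha < 2 -> alpha - 1 <= beta <= 1 ->
  is_q r alpha beta f q ->
  let a := alpha - beta in
  let u := fun x => (q x - qN r alpha beta f N x) / rho a beta x in
  L2w a beta u /\
  sqnorm a beta (fun x => u x - (jacobi_sum a beta (error_coef alpha beta f N) n).[x])
    @[n --> \oo] --> (0 : R).
Proof.
move=> /andP[al1 al2] /andP[b1 b2] [qs cq] a u.
have a0 : -1 < a by rewrite /a; lra.
have b0 : -1 < beta by lra.
have qsL2 := inL2_L2w qs.
have qnL2 n : L2w (- a) (- beta) (fun x => q x - qN r alpha beta f n x).
  apply: L2w_eq (L2wB qsL2 (L2w_rho_poly (jacobi_sum a beta (ccoef alpha beta f) n) a0 b0)) => x _.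
  by rewrite qN_poly; ring.
have uL2 : L2w a beta u by exact: L2w_div_rho.
split => //.
have c1 : sqnorm (- a) (- beta) (fun x => q x - qN r alpha beta f n x) @[n --> \oo] --> (0 : R).
  apply: cvg_sqnorm => //; apply: cvg_trans cq.
  apply: near_eq_cvg; apply: nearW => n; congr L2norm; apply/funext => x.
  by ring.
apply: cvg_trans c1; apply: near_eq_cvg; near=> n.
have Nn : (N <= n)%N by near: n; exact: nbhs_infty_ge.
rewrite -sqnorm_div_rho; apply: sqnorm_eq => x x01.
have r0 : rho a beta x != 0 by rewrite gt_eqF// rho_gt0.
have := qNB r alpha beta f x Nn; rewrite -/a /u => E.
rewrite (_ : (jacobi_sum _ _ _ _).[x] =
  (qN r alpha beta f n x - qN r alpha beta f N x) / rho a beta x); last by rewrite E; field.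
by field.
Unshelve. all: by end_near. Qed.

(** The bound depends on m rather than on l, so that all seminorms of order at most m share it and
    can be added. *)
Lemma expansion_error_term r d alpha beta f q (N l m j : nat) :
  1 < alpha < 2 -> alpha - 1 <= beta <= 1 ->
  0 < d -> d ^+ 2 <= (sin (pi * alpha) / sin_sum alpha beta) ^+ 2 ->
  L2w (beta - 1) (alpha - beta - 1) f -> weakly_derivable j f ->
  L2w (beta - 1 + j%:R) (alpha - beta - 1 + j%:R) (weakD j f) ->
  is_q r alpha beta f q ->
  (0 < N)%N -> (0 < j)%N -> (l <= m)%N -> (m <= j)%N -> (j <= N.+1)%N ->
  (seminormA l (alpha - beta)%R beta
    (fun x => (q x - qN r alpha beta f N x) / rho (alpha - beta) beta x)%R ^+ 2 <=
   ((2 ^+ j * j%:R ^+ j * 4 / d ^+ 2) *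
    (N%:R `^ (- (alpha - 1)) * (N%:R * (N%:R + alpha - 2)) `^ ((m%:R - j%:R) / 2)) ^+ 2 *
    sqnorm (beta - 1 + j%:R) (alpha - beta - 1 + j%:R) (weakD j f))%R%:E)%E.
Proof.
move=> a12 b12 d0 dK fL2 wf gL2 hq N0 j0 lm mj jN.
have [uL2 cu] := expansion_error_L2 N a12 b12 hq.
set u := (fun x => (q x - _) / _) in uL2 cu *.
have /andP[a1 a2] := a12; have /andP[b1 b2] := b12.
have am1 : -1 < alpha - beta by lra.
have bm1 : -1 < beta by lra.
have am1' : -1 < alpha - beta - 1 by lra.
have bm1' : -1 < beta - 1 by lra.
have fg : weak_derivative j f (weakD j f) by exact: getPex.
set G2 := sqnorm _ _ (weakD j f); set A := _ `^ _ * _ `^ _.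
set C2 := _ / d ^+ 2.
have C20 : 0 <= C2 by rewrite /C2 !mulr_ge0 ?invr_ge0 ?exprn_ge0 ?ler0n// ltW.
have CA0 : 0 <= C2 * A ^+ 2 by apply: mulr_ge0 => //; exact: sqr_ge0.
(* The coefficients of f in degree i + 1, recovered as lambda_i c_i and switched off below N; degree
   0 belongs to c_{-1} and is dropped. *)
pose e n := if n is i.+1 then lambda alpha beta i * error_coef alpha beta f N i else 0.
have eE : beta - 1 + (alpha - beta - 1) = alpha - 2 by ring.
have he n : e n * int01 (fun x => rho (beta - 1) (alpha - beta - 1) x * f x *
      (shifted_jacobi n (beta - 1) (alpha - beta - 1)).[x]) =
    e n ^+ 2 * jacobi_sqnorm n (beta - 1) (alpha - beta - 1).
  case: n => [|i]; first by rewrite /e expr0n/= !mul0r.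
  rewrite /e /error_coef; have [iN|Ni] := ltnP i N; first by rewrite mulr0 expr0n/= !mul0r.
  have -> : int01 (fun x => rho (beta - 1) (alpha - beta - 1) x * f x *
      (shifted_jacobi i.+1 (beta - 1) (alpha - beta - 1)).[x]) = fcoef alpha beta f i.+1.
    by apply: int01_eq => x _; rewrite GpolyE.
  have lam0 : lambda alpha beta i != 0.
    rewrite -sqrf_eq0 gt_eqF//.
    apply: lt_le_trans (lambda_lower_bound a12 d0 dK Ni).
    by rewrite exprn_gt0// divr_gt0// mulr_gt0// powR_gt0// ltr0n.
  (* If the norm is 0, its inverse is 0 by convention and both sides vanish. *)
  rewrite /ccoef Gnorm_sqr; have [->|k0] := eqVneq (jacobi_sqnorm i.+1 (beta - 1) (alpha - beta - 1)) 0.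
    by rewrite !mulr0 invr0 !mulr0 mul0r.
  by field; rewrite lam0 k0.
have bessel n := weak_bessel n bm1' am1' fL2 gL2 fg he.
have bound n : \sum_(i < n) error_coef alpha beta f N i ^+ 2 *
    (jacobi_eigen l i (alpha - beta + beta) * jacobi_sqnorm i (alpha - beta) beta) <= C2 * A ^+ 2 * G2.
  apply: (@le_trans _ _ (C2 * A ^+ 2 * \sum_(i < n) (lambda alpha beta i * error_coef alpha beta f N i) ^+ 2 *
     (jacobi_eigen j i.+1 (alpha - 2) * jacobi_sqnorm i.+1 (beta - 1) (alpha - beta - 1)))); last first.
    (* One more term than on the q side: the extra one is degree 0, where [e] vanishes. *)
    rewrite ler_wpM2l//; have := bessel n.+1.
    rewrite big_ord_recl [e ord0]/= expr0n mul0r add0r eE; apply: le_trans.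
    by rewrite le_eqVlt; apply/orP; left; apply/eqP; apply: eq_bigr.
  rewrite mulr_sumr; apply: ler_sum => i _.
  rewrite /error_coef; have [iN|Ni] := ltnP i N; first by rewrite mulr0 expr0n/= !mul0r mulr0.
  rewrite subrK [(lambda _ _ _ * _) ^+ 2]exprMn.
  have := jacobi_term_bound a12 b12 d0 dK N0 Ni j0 lm mj jN; rewrite -/A -/C2.
  move: (lambda _ _ _ ^+ 2) (jacobi_eigen l _ _ * _) (jacobi_eigen j _ _ * _) (C2 * A ^+ 2).
  move=> L2 x y K h; rewrite [leRHS](_ : _ = ccoef alpha beta f i ^+ 2 * (K * (L2 * y))); last by ring.
  by rewrite ler_wpM2l ?sqr_ge0.
have [g ug [gL2' gM]] := weak_derivative_jacobi_series am1 bm1 uL2 cu bound.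
rewrite /seminormA (_ : `[< _ >] = true); last by apply/asboolP; exists g.
rewrite (L2norm_weakD _ _ ug) L2normE// -EFin_expe lee_fin sqr_sqrtr//.
exact: sqnorm_ge0.
Qed.

End ExpansionError.

Theorem corollary4p1 (R : realType) (r alpha0 : R) (j mu : nat) :
  2^-1 <= r <= 1 ->
  1 <= alpha0 -> (2^-1 < r \/ 1 < alpha0) ->
  (0 < j)%N -> (mu <= j)%N ->
  exists2 C : R, 0 < C &
    forall (alpha beta : R) (f q : R -> R) (N : nat),
      1 < alpha < 2 -> alpha0 <= alpha ->
      is_beta r alpha beta ->
      inL2 (rho (beta - 1) (alpha - beta - 1)) f ->
      weakly_derivable j f ->
      inL2 (rho (beta + j%:R - 1) (alpha - beta + j%:R - 1)) (weakD j f) ->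
      is_q r alpha beta f q ->
      (0 < N)%N -> (j <= N.+1)%N ->
      (normA mu (alpha - beta)%R beta
         (fun x => (q x - qN r alpha beta f N x) / rho (alpha - beta) beta x)%R
       <= (C * N%:R `^ (- (alpha - 1))
             * (N%:R * (N%:R + alpha - 2)) `^ ((mu%:R - j%:R) / 2))%R%:E
          * seminormA j (beta - 1)%R (alpha - beta - 1)%R f)%E.
Proof.
move=> r12 a01 hra j0 muj.
have [d d0 hd] := sin_ratio_lower_bound r12 a01 hra.
pose C2 : R := 2 ^+ j * j%:R ^+ j * 4 / d ^+ 2.
have C20 : 0 < C2 by rewrite /C2 divr_gt0// ?mulr_gt0 ?exprn_gt0// ltr0n.
(* The squared norm has mu + 1 summands, each bounded with the factor [C2], which depends only on j
   and, through d, on r and [alpha0]. *)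
exists (Num.sqrt (mu.+1%:R * C2)); first by rewrite sqrtr_gt0 mulr_gt0// ltr0n.
move=> alpha beta f q N a12 a0a hb fL2 wf gL2 hq N0 jN.
have dK := hd _ _ a12 a0a hb; have [b12 _] := hb.
have fL2' := inL2_L2w fL2; have := inL2_L2w gL2.
rewrite !(addrAC _ j%:R) => gL2'.
set u := (fun x => (q x - _) / _).
set A := N%:R `^ (- (alpha - 1)); set B := (N%:R * _) `^ _.
have AB0 : 0 <= A * B by rewrite mulr_ge0// powR_ge0.
set G2 := sqnorm (beta - 1 + j%:R) (alpha - beta - 1 + j%:R) (weakD j f).
have sf : seminormA j (beta - 1) (alpha - beta - 1) f = (Num.sqrt G2)%:E.
  by rewrite /seminormA (_ : `[< _ >] = true) ?L2normE//; exact/asboolP.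
have G20 : 0 <= G2 by exact: sqnorm_ge0.
have mC20 : 0 <= mu.+1%:R * C2 by apply: mulr_ge0; [exact: ler0n|exact: ltW].
have M0 : 0 <= C2 * (A * B) ^+ 2 * G2.
  by apply: mulr_ge0 => //; apply: mulr_ge0; [exact: ltW|exact: sqr_ge0].
rewrite sf -EFinM -mulrA /normA.
have -> : Num.sqrt (mu.+1%:R * C2) * (A * B) * Num.sqrt G2 =
    Num.sqrt (mu.+1%:R * (C2 * (A * B) ^+ 2 * G2)).
  rewrite [RHS](_ : _ = Num.sqrt (mu.+1%:R * C2 * (A * B) ^+ 2 * G2)); last by rewrite !mulrA.
  rewrite [in RHS]sqrtrM; last by apply: mulr_ge0 => //; exact: sqr_ge0.
  rewrite [in RHS]sqrtrM//.
  by rewrite sqrtr_sqr ger0_norm.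
rewrite -[leRHS]/(sqrte (mu.+1%:R * (C2 * (A * B) ^+ 2 * G2))%:E).
rewrite lee_sqrt; last by rewrite lee_fin mulr_ge0// ler0n.
apply: (@le_trans _ _ (\sum_(l < mu.+1) (C2 * (A * B) ^+ 2 * G2)%:E)%E).
  apply: lee_sum => l _.
  by apply: (expansion_error_term a12 b12 d0 dK fL2' wf gL2' hq N0 j0 _ muj jN); rewrite -ltnS.
by rewrite sumEFin sumr_const card_ord mulr_natl.
Qed.
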